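(* Let $\Gamma$ be a discrete and countable abelian group, let $\Pi$ be a unitary representation of $\Gamma$ on a separable Hilbert space $\mathcal{H}$, and suppose that $(\Gamma,\Pi,\mathcal{H})$ is a dual integrable triple. Let $[\cdot,\cdot]^{op}:\mathcal{H}\times\mathcal{H}\to L^1(\mathscr{R}(\Gamma))$ be the operator Bracket map and $[\cdot,\cdot]:\mathcal{H}\times\mathcal{H}\to L^1(\widehat{\Gamma})$ the function-valued Bracket map. If $\psi_1,\psi_2\in\mathcal{H}$, then $$\Lambda([\psi_1,\psi_2]^{op})=[\psi_1,\psi_2]$$ as elements of $L^1(\widehat{\Gamma})$, where $\Lambda:L^1(\mathscr{R}(\Gamma))\to L^1(\widehat{\Gamma})$ is the multiplier map.
   Context: Inner products are linear in the first variable. $\widehat{\Gamma}$ is the compact dual group of characters $\alpha$ of $\Gamma$, with normalized Haar measure $d\alpha$, and $X_\gamma(\alpha)=\alpha(\gamma)$ for $\gamma\in\Gamma$, $\alpha\in\widehat{\Gamma}$. Right von Neumann algebra. Let $\{\delta_\gamma\}_{\gamma\in\Gamma}$ be the canonical basis of $\ell_2(\Gamma)$, $\mathrm{e}$ the identity of $\Gamma$, and $\rho:\Gamma\to U(\ell_2(\Gamma))$ the right regular representation, $\rho(\gamma)\delta_{\gamma'}=\delta_{\gamma'\gamma^{-1}}$. The right von Neumann algebra $\mathscr{R}(\Gamma)$ is the closure of $\mathrm{span}\{\rho(\gamma)\}_{\gamma\in\Gamma}$ in the weak operator topology. Its standard trace is $\tau(F)=\langle F\delta_{\mathrm{e}},\delta_{\mathrm{e}}\rangle_{\ell_2(\Gamma)}$.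 $L^1(\mathscr{R}(\Gamma))$ is the completion of $S(\Gamma)=\mathrm{span}\{\rho(\gamma)\}_{\gamma\in\Gamma}$ in the norm $\|F\|_1=\tau(|F|)$; its elements are identified with densely defined closed operators on $\ell_2(\Gamma)$ affiliated to $\mathscr{R}(\Gamma)$. The trace $\tau$ extends to $L^1(\mathscr{R}(\Gamma))$, the Fourier coefficients of $F\in L^1(\mathscr{R}(\Gamma))$ are $\widehat{F}(\gamma)=\tau(F\rho(\gamma))$, and they determine $F$ uniquely. Multiplier map. On $S(\Gamma)$, $\Lambda$ maps the finite sum $F=\sum_\gamma\widehat{F}(\gamma)\rho(\gamma)^*$ to $\Lambda(F)=\sum_\gamma\widehat{F}(\gamma)\overline{X_\gamma}$. It extends by density to an isometric isomorphism $\Lambda:L^1(\mathscr{R}(\Gamma))\to L^1(\widehat{\Gamma})$. Dual integrability. $\Pi$ is dual integrable, and $(\Gamma,\Pi,\mathcal{H})$ is called a dual integrable triple, if there is a sesquilinear map $[\cdot,\cdot]^{op}:\mathcal{H}\times\mathcal{H}\to L^1(\mathscr{R}(\Gamma))$ (the operator Bracket map) such that $\langle\varphi,\Pi(\gamma)\psi\rangle_{\mathcal{H}}=\tau([\varphi,\psi]^{op}\rho(\gamma))$ for all $\varphi,\psi\in\mathcal{H}$, $\gamma\in\Gamma$. For abelian $\Gamma$ it is known that this is equivalent to the existence of a sesquilinear map $[\cdot,\cdot]:\mathcal{H}\times\mathcal{H}\to L^1(\widehat{\Gamma})$ (the function-valued Bracket map) such that $\langle\varphi,\Pi(\gamma)\psi\rangle_{\mathcal{H}}=\int_{\widehat{\Gamma}}[\varphi,\psi](\alpha)\,\alpha(\gamma)\,d\alpha$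 for all $\varphi,\psi\in\mathcal{H}$, $\gamma\in\Gamma$; so for a dual integrable triple with $\Gamma$ abelian both maps exist. *)

(* Defs.v *)
From HB Require Import structures.
From mathcomp Require Import all_boot all_order all_algebra.
From mathcomp Require Import generic_quotient ring_quotient sesquilinear.
From mathcomp Require Import finmap complex ring.
From mathcomp Require Import all_classical all_reals all_analysis.

Set Implicit Arguments.
Unset Strict Implicit.
Unset Printing Implicit Defensive.

Import Order.TTheory GRing.Theory Num.Theory.
Import numFieldNormedType.Exports.

Local Open Scope classical_set_scope.
Local Open Scope quotient_scope.
Local Open Scope ring_scope.

(* R[i] itself carries no canonical topology in the library; seen through the
   [numClosedFieldType] projection it gets the one given by the modulus. *)
Definition Cplx (R : realType) : numClosedFieldType := R[i].

Section ComplexL1.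
Context d (T : measurableType d) (R : realType).
Variable mu : {measure set T -> \bar R}.
Local Notation C := (Cplx R).

Definition cintegrable : {pred T -> C} := fun f =>
  mu.-integrable setT (EFin \o (fun x => complex.Re (f x))) &&
  mu.-integrable setT (EFin \o (fun x => complex.Im (f x))).

Definition cintegral (f : T -> C) : C :=
  Complex (Rintegral mu setT (fun x => complex.Re (f x)))
          (Rintegral mu setT (fun x => complex.Im (f x))).

Lemma cintegrable_submod_closed : submod_closed cintegrable.
Proof.
split=> [|a f g].
  rewrite unfold_in; apply/andP; split; apply: eq_integrable (integrable0 _ _) => //.
move=> /andP[fr fi] /andP[gr gi]; rewrite unfold_in; apply/andP.
have h (u v : T -> R) (b c : R) :
    mu.-integrable setT (EFin \o u) -> mu.-integrable setT (EFin \o v) ->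
    mu.-integrable setT (EFin \o (fun x => b * u x + c * v x)).
  move=> iu iv.
  have -> : EFin \o (fun x => b * u x + c * v x) =
      ((fun x => b%:E * (EFin \o u) x) \+ (fun x => c%:E * (EFin \o v) x))%E.
    by apply/funext => x /=; rewrite EFinD !EFinM.
  by apply: integrableD => //; apply: integrableZl.
case: a => p q; split.
- have k := h _ _ 1 1 (h _ _ p (- q) fr fi) gr.
  apply: eq_integrable k => // x _ /=; congr EFin.
  change ((f x : R[i]) : R[i]) with (f x).
  rewrite !mul1r; rewrite [in RHS]/GRing.add /= /GRing.scale /=.
  by case: (f x) => u v; case: (g x) => u' v' /=; rewrite mulNr.
- have k := h _ _ 1 1 (h _ _ p q fi fr) gi.
  apply: eq_integrable k => // x _ /=; congr EFin.
  rewrite !mul1r; rewrite [in RHS]/GRing.add /= /GRing.scale /=.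
  by case: (f x) => u v; case: (g x) => u' v' /=.
Qed.

HB.instance Definition _ :=
  GRing.isSubmodClosed.Build C (T -> C) cintegrable cintegrable_submod_closed.

Record L1fun := MkL1fun { L1fun_val :> T -> C ; _ : L1fun_val \in cintegrable }.

HB.instance Definition _ := [isSub of L1fun for L1fun_val].
HB.instance Definition _ := [Choice of L1fun by <:].
HB.instance Definition _ := [SubChoice_isSubLmodule of L1fun by <:].

Definition L1null : {pred L1fun} := fun f => `[< {ae mu, forall x, f x = 0} >].

Lemma L1null_submod_closed : submod_closed L1null.
Proof.
split=> [|a f g].
  by apply/asboolP; apply: aeW.
move=> /asboolP f0 /asboolP g0; apply/asboolP.
by apply: filterS2 f0 g0 => x /= f0 g0; rewrite /= !fctE f0 g0 scaler0 addr0.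
Qed.

HB.instance Definition _ :=
  GRing.isSubmodClosed.Build C L1fun L1null L1null_submod_closed.

(* Complex-valued integrable functions modulo equality almost everywhere. *)
Definition L1 : Type := Quotient.quot L1null.
HB.instance Definition _ := GRing.Zmodule.on L1.

Definition L1scale (a : C) (u : L1) : L1 := \pi_(Quotient.quot L1null) (a *: repr u).

Lemma pi_L1scale a (f : L1fun) :
  L1scale a (\pi_(Quotient.quot L1null) f) = \pi_(Quotient.quot L1null) (a *: f).
Proof.
apply/eqP; rewrite -Quotient.idealrBE -scalerBr rpredZ//.
by rewrite Quotient.idealrBE reprK.
Qed.

Lemma L1scaleA a b u : L1scale a (L1scale b u) = L1scale (a * b) u.
Proof. by elim/quotW: u => f; rewrite (pi_L1scale b f) !pi_L1scale scalerA. Qed.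

Lemma L1scale1 : left_id 1 L1scale.
Proof. by elim/quotW => f; rewrite pi_L1scale scale1r. Qed.

Lemma L1scaleDr : right_distributive L1scale +%R.
Proof.
move=> a; elim/quotW => f; elim/quotW => g.
rewrite !pi_L1scale [RHS]/GRing.add /= -!Quotient.pi_add -scalerDr.
by rewrite -pi_L1scale; congr L1scale; rewrite Quotient.pi_add.
Qed.

Lemma L1scaleDl u : {morph L1scale^~ u : a b / a + b}.
Proof.
elim/quotW: u => f a b.
by rewrite !pi_L1scale [RHS]/GRing.add /= -!Quotient.pi_add -scalerDl.
Qed.

HB.instance Definition _ := GRing.Zmodule_isLmodule.Build C L1
  L1scaleA L1scale1 L1scaleDr L1scaleDl.

(* The class of f in L1; the null class if f is not integrable. *)
Definition L1class (f : T -> C) : L1 :=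
  \pi_(Quotient.quot L1null) (insubd (0 : L1fun) f).

Definition L1repr (u : L1) : L1fun := repr (u : Quotient.quot L1null).

Definition L1norm (u : L1) : C := cintegral (fun x => `|L1repr u x|).

End ComplexL1.

Section DualGroup.
Variables (R : realType) (G : zmodType).
Local Notation C := (Cplx R).

Record character := Character {
  character_val :> G -> C;
  character_unit : forall g, `|character_val g| = 1;
  characterD : forall g h,
    character_val (g + h) = character_val g * character_val h }.

Lemma character_inj : injective character_val.
Proof.
move=> [f f1 fD] [g g1 gD] /= fg; move: f1 fD g1 gD; rewrite fg => *.
by congr Character; exact: Prop_irrelevance.
Qed.

Lemma character1_unit (g : G) : `|(1 : C)| = 1. Proof. exact: normr1. Qed.

Lemma character1D (g h : G) : (1 : C) = 1 * 1. Proof. by rewrite mulr1. Qed.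

Definition character1 : character :=
  @Character (fun=> 1) character1_unit character1D.

Lemma characterM_unit (a b : character) (g : G) : `|a g * b g| = 1.
Proof. by rewrite normrM !character_unit mulr1. Qed.

Lemma characterM_D (a b : character) (g h : G) :
  a (g + h) * b (g + h) = (a g * b g) * (a h * b h).
Proof. by rewrite !characterD mulrACA. Qed.

Definition characterM (a b : character) : character :=
  @Character (fun g => a g * b g) (characterM_unit a b) (characterM_D a b).

HB.instance Definition _ := gen_eqMixin character.
HB.instance Definition _ := gen_choiceMixin character.
HB.instance Definition _ := isPointed.Build character character1.

(* The dual topology of a discrete group: compact-open convergence is pointwise
   convergence. *)
HB.instance Definition _ := Topological.copy character
  (initial_topology (character_val : character -> {ptws G -> C})).

(* The dual group with its Borel sigma-algebra. *)
Definition dual : Type := g_sigma_algebraType (@open character).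
HB.instance Definition _ := Measurable.on dual.

(* Normalized Haar measure; regularity is automatic, the dual of a countable
   group being compact metrizable. *)
Definition is_haar (m : probability dual R) : Prop :=
  forall (a : character) (A : set dual), measurable A ->
    m ((characterM a : dual -> dual) @` A) = m A.

Definition Xchar (g : G) : dual -> C := fun a => (a : character) g.

End DualGroup.

Section Ell2.
Variables (R : realType) (G : zmodType).
Local Notation C := (Cplx R).

Definition cabs2 (z : C) : R := complex.Re z ^+ 2 + complex.Im z ^+ 2.

Definition ell2_pred : {pred G -> C} := fun f =>
  (\esum_(g in [set: G]) (cabs2 (f g))%:E < +oo)%E.

Lemma cabs2_ge0 z : 0 <= cabs2 z.
Proof. by rewrite addr_ge0// sqr_ge0. Qed.

Lemma cabs2D z w : cabs2 (z + w) <= 2 * cabs2 z + 2 * cabs2 w.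
Proof.
case: z w => a b [c e]; rewrite /cabs2 /= -subr_ge0.
rewrite [leRHS](_ : _ = (a - c) ^+ 2 + (b - e) ^+ 2); last by ring.
by rewrite addr_ge0// sqr_ge0.
Qed.

Lemma cabs2M z w : cabs2 (z * w) = cabs2 z * cabs2 w.
Proof. by case: z w => a b [c e]; rewrite /cabs2 /=; ring. Qed.

Lemma ell2_submod_closed : submod_closed ell2_pred.
Proof.
have esumZ (b : R) (f : G -> C) : 0 <= b -> f \in ell2_pred ->
    (\esum_(g in [set: G]) (b * cabs2 (f g))%:E < +oo)%E.
  move=> b0 fl.
  apply: (@le_lt_trans _ _ (b%:E * \esum_(g in [set: G]) (cabs2 (f g))%:E)%E).
    apply: ge_ereal_sup => _ [A Aset <-].
    apply: (@le_trans _ _ (b%:E * \sum_(g \in A) (cabs2 (f g))%:E)%E).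
      rewrite ge0_mule_fsumr; last by move=> g; rewrite lee_fin cabs2_ge0.
      by apply: lee_fsum => [|g _]; [case: Aset|rewrite EFinM].
    apply: lee_wpmul2l; first by rewrite lee_fin.
    by apply: ereal_sup_ubound; exists A.
  by rewrite lte_mul_pinfty ?lee_fin.
split=> [|a f g fl gl]; rewrite unfold_in.
  rewrite esum1 ?ltry// => g _; congr EFin.
  by rewrite /cabs2 /= expr0n addr0.
have h2 : (0 : R) <= 2 by [].
have fb := esumZ (2 * cabs2 a) f (mulr_ge0 h2 (cabs2_ge0 a)) fl.
have gb := esumZ 2 g h2 gl.
apply: le_lt_trans (lte_add_pinfty fb gb).
rewrite -esumD; first last.
- by move=> x _; rewrite lee_fin mulr_ge0// cabs2_ge0.
- by move=> x _; rewrite lee_fin !mulr_ge0// cabs2_ge0.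
apply: le_esum => x _; rewrite -EFinD lee_fin.
by apply: le_trans (cabs2D _ _) _; rewrite cabs2M mulrA.
Qed.

HB.instance Definition _ :=
  GRing.isSubmodClosed.Build C (G -> C) ell2_pred ell2_submod_closed.

Record ell2 := MkEll2 { ell2_val :> G -> C ; _ : ell2_val \in ell2_pred }.

HB.instance Definition _ := [isSub of ell2 for ell2_val].
HB.instance Definition _ := [Choice of ell2 by <:].
HB.instance Definition _ := [SubChoice_isSubLmodule of ell2 by <:].

(* Unconditional sum of an absolutely summable real family. *)
Definition rsum (a : G -> R) : R :=
  fine (\esum_(g in [set: G]) (EFin \o a)^\+ g -
        \esum_(g in [set: G]) (EFin \o a)^\- g)%E.

Definition ell2_dot (x y : ell2) : C :=
  Complex (rsum (fun g => complex.Re (x g * (y g)^* )))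
          (rsum (fun g => complex.Im (x g * (y g)^* ))).

Definition delta_fun (g : G) : G -> C := fun h => (h == g)%:R.

Lemma delta_ell2 g : delta_fun g \in ell2_pred.
Proof.
rewrite unfold_in (esumID [set g]); last by move=> h _; rewrite lee_fin cabs2_ge0.
rewrite setTI esum_set1 ?lee_fin ?cabs2_ge0// esum1 ?adde0 ?ltry//.
move=> h [_ /eqP/negPf hg]; congr EFin.
by rewrite /delta_fun hg /cabs2 /= expr0n addr0.
Qed.

Definition delta (g : G) : ell2 := MkEll2 (delta_ell2 g).

Lemma rho_ell2 (g : G) (x : ell2) : (fun h => x (h + g)) \in ell2_pred.
Proof.
case: x => x xl /=; rewrite unfold_in.
rewrite -(reindex_esum [set: G] [set: G] (fun h => h + g)
           (fun h => (cabs2 (x h))%:E))//.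
split=> // [h k _ _ /addIr//|h _]; exists (h - g) => //.
by rewrite subrK.
Qed.

(* The group is written additively: rho g (delta h) = delta (h - g). *)
Definition rho (g : G) (x : ell2) : ell2 := MkEll2 (rho_ell2 g x).

Lemma rho_delta g h : rho g (delta h) = delta (h - g).
Proof.
apply: val_inj; apply/funext => k /=.
by rewrite /delta_fun [k == _]eq_sym subr_eq eq_sym.
Qed.

Definition span_rho : set (ell2 -> ell2) :=
  [set F | exists (s : seq G) (c : G -> C), F = \sum_(g <- s) c g *: rho g].

Definition bounded_op (F : ell2 -> ell2) : Prop :=
  linear F /\ exists M : C, forall x, ell2_dot (F x) (F x) <= M * ell2_dot x x.

Definition positive_op (F : ell2 -> ell2) : Prop :=
  forall x, 0 <= ell2_dot (F x) x.

Definition adjoint (F : ell2 -> ell2) : ell2 -> ell2 :=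
  xget 0 [set F' | forall x y, ell2_dot (F x) y = ell2_dot x (F' y)].

(* |F|, the positive square root of F^* F *)
Definition abs_op (F : ell2 -> ell2) : ell2 -> ell2 :=
  xget 0 [set P | [/\ bounded_op P, positive_op P & P \o P = adjoint F \o F]].

Definition tau (F : ell2 -> ell2) : C := ell2_dot (F (delta 0)) (delta 0).

Definition trace_norm (F : ell2 -> ell2) : C := tau (abs_op F).

(* The coefficient of rho(g)^* in F. *)
Definition fourier (F : ell2 -> ell2) (g : G) : C := tau (F \o rho g).

End Ell2.
Arguments rho {R G}.
Arguments span_rho {R G}.

Section NoncommutativeL1.
Variables (R : realType) (G : zmodType).
Local Notation C := (Cplx R).
Local Notation op := (ell2 R G -> ell2 R G).

(* (E, j) is the completion of span {rho g} for the norm tau(|F|), which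
   determines it up to a unique isometric isomorphism; the values of j outside
   this span are irrelevant. *)
Definition is_L1_completion (E : completeNormedModType C) (j : op -> E) : Prop :=
  [/\ forall (a : C) (F F' : op), span_rho F -> span_rho F' ->
        j (a *: F + F') = a *: j F + j F',
      forall F : op, span_rho F -> `|j F| = trace_norm F &
      dense (j @` span_rho)].

Variables (E : completeNormedModType C) (j : op -> E).

(* Extension by continuity to E of a map f defined on the span. *)
Definition extend (W : pnbhsType) (f : op -> W) (x : E) : W :=
  lim (f @ filter_from (nbhs x) (fun U => span_rho `&` j @^-1` U)).

Definition tauL1 : E -> C := extend (@tau R G).

Definition mulL1_rho (g : G) : E -> E := extend (fun F => j (F \o rho g)).

(* The Fourier coefficient tau(x rho(g)). *)
Definition fourierL1 (x : E) (g : G) : C := tauL1 (mulL1_rho g x).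

Variable m : probability (dual R G) R.

(* The isometric isomorphism extending the map given on finite sums; the first
   clause determines it, by density. *)
Definition is_multiplier_map (Lambda : {linear E -> L1 m}) : Prop :=
  [/\ forall (s : {fset G}) (F : op),
        F = \sum_(g <- s) fourier F g *: adjoint (rho g) ->
        Lambda (j F) =
          \sum_(g <- s) fourier F g *: L1class m (fun a => (Xchar g a)^* ),
      forall x, L1norm (Lambda x) = `|x| &
      bijective Lambda].

End NoncommutativeL1.

Section DualIntegrability.
Variables (R : realType) (G : zmodType) (H : completeNormedModType (Cplx R)).
Variable ip : {dot H for Num.conj}.
Local Notation C := (Cplx R).
Local Notation op := (ell2 R G -> ell2 R G).

Definition is_unitary_rep (Pi : G -> {linear H -> H}) : Prop :=
  [/\ forall x, Pi 0 x = x,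
      forall g h x, Pi (g + h) x = Pi g (Pi h x),
      forall g, bijective (Pi g) &
      forall g x y, ip (Pi g x) (Pi g y) = ip x y].

Variable Pi : G -> {linear H -> H}.

Definition is_operator_bracket (E : completeNormedModType C) (j : op -> E)
    (br : {bilinear H -> H -> E | *:%R & (Num.conj : C -> C) \; *:%R}) : Prop :=
  forall phi psi g, ip phi (Pi g psi) = fourierL1 j (br phi psi) g.

Definition dual_integrable (E : completeNormedModType C) (j : op -> E) : Prop :=
  exists br, @is_operator_bracket E j br.

Definition is_function_bracket (m : probability (dual R G) R)
    (br : {bilinear H -> H -> L1 m | *:%R & (Num.conj : C -> C) \; *:%R}) : Prop :=
  forall phi psi g,
    ip phi (Pi g psi) = cintegral m (fun a => L1repr (br phi psi) a * Xchar g a).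

End DualIntegrability.

(* Main.v *)
Require Import Defs.
From HB Require Import structures.
From mathcomp Require Import all_boot all_order all_algebra.
From mathcomp Require Import generic_quotient ring_quotient sesquilinear.
From mathcomp Require Import finmap complex ring lra.
From mathcomp Require Import all_classical all_reals all_analysis.
From mathcomp Require Import measurable_realfun.
Import Order.TTheory GRing.Theory Num.Theory.
Import numFieldNormedType.Exports.

(** Both brackets of [psi1] and [psi2] have the same Fourier coefficients
    [ip psi1 (Pi g psi2)], so the theorem amounts to two facts: the multiplier
    map [Lambda] transports Fourier coefficients, and an element of L1 of the
    dual group is determined by its Fourier coefficients.

    Transport ([fourierL1E]).  On the span of the translations [rho h] the map
    [Lambda] sends [rho h] to the class of the character [Xchar h], because
    [rho h] is the adjoint of [rho (- h)].  Hence composing with [rho g] on the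
    right corresponds to multiplying by [Xchar g], which is isometric on L1, and
    the trace corresponds to the integral, which is continuous on L1.  The
    extensions by continuity that define [fourierL1] are therefore computed by
    continuous maps which are already defined everywhere ([extend_continuous]).
    That the trace is the integral rests on the orthogonality relation
    [integral_Xchar], which follows from invariance of the Haar measure once
    there is a character [a] with [a g != 1].  Such a character is obtained from
    [Lambda] itself ([character_neq1]): if all characters were 1 at [g != 0],
    then [Lambda] would kill the positive operator [2 - rho g - rho (- g)], whose
    trace norm is nonzero ([trace_norm_laplacian]); but [Lambda] is injective.

    Uniqueness ([Fourier_inj]).  For a real integrable [u], orthogonality to all
    characters is preserved when [u] is multiplied by the real or imaginary part
    of a character (product-to-sum formulas), hence by polynomials in it, hence,
    by dominated convergence along explicit polynomials that converge to the
    indicator of a half line, by the indicator of a half space of the dual, and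
    so by indicators of finite intersections of half spaces.  These form a
    pi-system that generates the Borel sets since the group is countable
    ([dual_measurableE]).  Dynkin's lemma gives that [u] has zero integral on
    every Borel set, thus vanishes almost everywhere. *)

Set Implicit Arguments.
Unset Strict Implicit.
Unset Printing Implicit Defensive.
Local Open Scope classical_set_scope.
Local Open Scope ring_scope.

(** * Sums of absolutely summable real families *)

Section Rsum.
Variables (R : realType) (G : zmodType).
Implicit Types (a b u v : G -> R).

Let nsum u : R := fine (\esum_(g in [set: G]) (u g)%:E).
Let asum a := summable [set: G] (EFin \o a).

Lemma summable_ge0 u : (forall g, 0 <= u g) ->
  (\esum_(g in [set: G]) (u g)%:E < +oo)%E -> summable [set: G] (EFin \o u).
Proof.
move=> u0; apply: le_lt_trans; apply: le_esum => g _ /=.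
by rewrite ger0_norm.
Qed.

Lemma le_summable a b : (forall g, `|a g| <= b g) ->
  summable [set: G] (EFin \o b) -> summable [set: G] (EFin \o a).
Proof.
move=> ab; apply: le_lt_trans; apply: le_esum => g _ /=.
by rewrite lee_fin (le_trans (ab g))// ler_norm.
Qed.

Lemma summable_EFinD a b : summable [set: G] (EFin \o a) ->
  summable [set: G] (EFin \o b) -> summable [set: G] (EFin \o (a \+ b)).
Proof. by move=> sa sb; have := summableD sa sb. Qed.

Lemma summable_EFinZ c a : summable [set: G] (EFin \o a) ->
  summable [set: G] (EFin \o (fun g => c * a g)).
Proof.
move=> sa; rewrite /summable.
apply: (@le_lt_trans _ _ (`|c|%:E * \esum_(g in [set: G]) `|(a g)%:E|)%E).
  apply: ge_ereal_sup => _ [A [finA AT] <-].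
  apply: (@le_trans _ _ (`|c|%:E * \sum_(g \in A) `|(a g)%:E|)%E).
    rewrite ge0_mule_fsumr//.
    by apply: lee_fsum => // g _; rewrite /= normrM EFinM.
  rewrite lee_wpmul2l ?lee_fin//.
  by apply: ereal_sup_ubound; exists A.
by rewrite lte_mul_pinfty ?lee_fin.
Qed.

Let esum_fin u : asum u -> (forall g, 0 <= u g) ->
  (\esum_(g in [set: G]) (u g)%:E)%E \is a fin_num.
Proof.
move=> su u0; move: su; rewrite /asum summableE; congr (_ \is a fin_num).
by apply: eq_esum => x _ /=; rewrite ger0_norm.
Qed.

Let nsumD u v : asum u -> asum v -> (forall g, 0 <= u g) -> (forall g, 0 <= v g) ->
  nsum (u \+ v) = nsum u + nsum v.
Proof.
move=> su sv u0 v0; rewrite /nsum -fineD ?esum_fin//.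
rewrite -esumD => [//|x _|x _]; by rewrite lee_fin.
Qed.

Let nsumZ (c : R) u : asum u -> 0 <= c -> (forall g, 0 <= u g) ->
  nsum (fun g => c * u g) = c * nsum u.
Proof.
move=> su c0 u0.
have le k w : 0 <= k -> asum w -> (forall g, 0 <= w g) ->
    nsum (fun g => k * w g) <= k * nsum w.
  move=> k0 sw w0; rewrite -lee_fin EFinM !fineK ?esum_fin//; last 2 first.
    exact: summable_EFinZ.
    by move=> g; exact: mulr_ge0.
  apply: ge_ereal_sup => _ [A [finA AT] <-].
  apply: (@le_trans _ _ (k%:E * \sum_(g \in A) (w g)%:E)%E).
    rewrite ge0_mule_fsumr//.
  rewrite lee_wpmul2l ?lee_fin//.
  by apply: ereal_sup_ubound; exists A.
have [->|cn0] := eqVneq c 0.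
  rewrite mul0r /nsum esum1// => g _; by rewrite mul0r.
have cp : 0 < c by rewrite lt_neqAle eq_sym cn0.
apply/eqP; rewrite eq_le le//=.
have := @le c^-1 (fun g => c * u g).
rewrite invr_ge0 => /(_ c0 (summable_EFinZ _ su)).
have -> : (fun g => c^-1 * (c * u g)) = u by apply/funext => g; rewrite mulKf.
rewrite ler_pdivlMl//; apply=> g; exact: mulr_ge0.
Qed.

Lemma rsum_ge0E u : (forall g, 0 <= u g) ->
  rsum u = fine (\esum_(g in [set: G]) (u g)%:E).
Proof.
move=> u0; rewrite /rsum [X in (_ - X)%E]esum1.
  rewrite sube0; congr fine; apply: eq_esum => g _.
  by rewrite funeposE/=; apply/max_idPl; rewrite lee_fin.
move=> g _; rewrite funenegE /=; apply/max_idPr.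
by rewrite lee_fin oppr_le0.
Qed.

(** The positive part of a sum is not the sum of the positive parts: linearity
    of [rsum] goes through arbitrary differences of nonnegative families. *)
Let rsumE u v : asum u -> asum v -> (forall g, 0 <= u g) -> (forall g, 0 <= v g) ->
  rsum (fun g => u g - v g) = nsum u - nsum v.
Proof.
move=> su sv u0 v0; rewrite /rsum /nsum -fineB ?esum_fin//.
congr fine; apply: (@esumB R G setT (EFin \o u) (EFin \o v) su sv) => g _.
  by rewrite lee_fin.
by rewrite lee_fin.
Qed.

Let p a g : R := Num.max (a g) 0.
Let n a g : R := Num.max (- a g) 0.
Let p0 a g : 0 <= p a g. Proof. by rewrite /p le_max lexx orbT. Qed.
Let n0 a g : 0 <= n a g. Proof. by rewrite /n le_max lexx orbT. Qed.
Let pn a g : a g = p a g - n a g.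
Proof. rewrite /p /n; case: (lerP 0 (a g)) => h; case: (lerP 0 (- a g)) => k; lra. Qed.
Let sp a : asum a -> asum (p a).
Proof.
apply: le_lt_trans; apply: le_esum => g _ /=; rewrite lee_fin ger0_norm//.
by rewrite /p ge_max ler_norm normr_ge0.
Qed.
Let sn a : asum a -> asum (n a).
Proof.
apply: le_lt_trans; apply: le_esum => g _ /=; rewrite lee_fin ger0_norm//.
by rewrite /n ge_max -normrN ler_norm normr_ge0.
Qed.

Let rsum_pn a : asum a -> rsum a = nsum (p a) - nsum (n a).
Proof.
move=> sa; rewrite -rsumE//; [|exact: sp|exact: sn].
by congr rsum; apply/funext => g; exact: pn.
Qed.

Lemma rsumD a b : summable [set: G] (EFin \o a) ->
  summable [set: G] (EFin \o b) ->
  rsum (fun g => a g + b g) = rsum a + rsum b.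
Proof.
move=> sa sb.
have -> : (fun g => a g + b g) =
    (fun g => (p a \+ p b) g - (n a \+ n b) g).
  by apply/funext => g /=; rewrite {1}(pn a) {1}(pn b); ring.
have ha := sp sa; have hb := sp sb; have ka := sn sa; have kb := sn sb.
rewrite (rsum_pn sa) (rsum_pn sb) rsumE ?nsumD//; first by ring.
- exact: summable_EFinD.
- exact: summable_EFinD.
- by move=> g; rewrite addr_ge0.
- by move=> g; rewrite addr_ge0.
Qed.

Lemma rsumN a : summable [set: G] (EFin \o a) ->
  rsum (fun g => - a g) = - rsum a.
Proof.
move=> sa.
have -> : (fun g => - a g) = (fun g => n a g - p a g).
  by apply/funext => g; rewrite {1}(pn a); ring.
by rewrite (rsum_pn sa) rsumE ?opprB//; [exact: sn|exact: sp].
Qed.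

Lemma rsumZ c a : summable [set: G] (EFin \o a) ->
  rsum (fun g => c * a g) = c * rsum a.
Proof.
wlog c0 : c / 0 <= c.
  move=> h sa; have [/h|/ltW c0] := lerP 0 c; first exact.
  rewrite -[c]opprK mulNr -h ?oppr_ge0// -rsumN; last exact: summable_EFinZ.
  by congr rsum; apply/funext => g; rewrite !mulNr.
move=> sa.
have -> : (fun g => c * a g) = (fun g => c * p a g - c * n a g).
  by apply/funext => g; rewrite {1}(pn a); ring.
have ha := sp sa; have ka := sn sa.
rewrite (rsum_pn sa) rsumE ?nsumZ ?mulrBr//.
- exact: summable_EFinZ.
- exact: summable_EFinZ.
- by move=> g; rewrite mulr_ge0.
- by move=> g; rewrite mulr_ge0.
Qed.

Lemma rsum_ge0 a : (forall g, 0 <= a g) -> 0 <= rsum a.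
Proof.
by move=> a0; rewrite rsum_ge0E// fine_ge0// esum_ge0// => g _; rewrite lee_fin.
Qed.

Lemma rsum_shift h a : rsum (fun g => a (g + h)) = rsum a.
Proof.
have bij : set_bij [set: G] [set: G] (fun g => g + h).
  split=> // [g k _ _ /addIr//|g _]; exists (g - h) => //.
  by rewrite subrK.
rewrite /rsum; congr (fine (_ - _)).
  rewrite (reindex_esum [set: G] [set: G] _ (EFin \o a)^\+%E bij).
  by apply: eq_esum => g _; rewrite !funeposE.
rewrite (reindex_esum [set: G] [set: G] _ (EFin \o a)^\-%E bij).
by apply: eq_esum => g _; rewrite !funenegE.
Qed.

Lemma rsum1 h a : (forall g, g != h -> a g = 0) -> rsum a = a h.
Proof.
move=> a0.
have E (f : G -> \bar R) : (forall g, 0 <= f g)%E -> (forall g, g != h -> f g = 0)%E ->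
    (\esum_(g in [set: G]) f g = f h)%E.
  move=> f0 fh; rewrite (esumID [set h])// setTI esum_set1// esum1 ?adde0//.
  by move=> g [_ /eqP gh]; rewrite fh.
rewrite /rsum !E//.
- by have := congr1 (fun f => fine (f h)) (funeposneg (EFin \o a)) => /= ->.
- by move=> g gh; rewrite funenegE /= a0// oppr0 maxxx.
- by move=> g gh; rewrite funeposE /= a0// maxxx.
Qed.

Lemma ler_rsum h a : summable [set: G] (EFin \o a) -> (forall g, 0 <= a g) ->
  a h <= rsum a.
Proof.
move=> sa a0; rewrite rsum_ge0E// -lee_fin fineK ?esum_fin//.
rewrite (esumID [set h]) ?setTI ?esum_set1 ?leeDl ?lee_fin//.
- by apply: esum_ge0 => g _; rewrite lee_fin.
- by move=> g _; rewrite lee_fin.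
Qed.

End Rsum.

(** * The inner product of square-summable families *)

Section Ell2Dot.
Variables (R : realType) (G : zmodType).
Local Notation C := (Cplx R).
Implicit Types (x y z : ell2 R G) (c : C).

Lemma conjcE (a : C) : a^* = Complex (complex.Re a) (- complex.Im a) :> C.
Proof. by case: a. Qed.

Lemma ell2_summable x : summable [set: G] (fun g => (cabs2 (x g))%:E).
Proof.
case: x => x xl; apply: (@summable_ge0 R G (fun g => cabs2 (x g))) => // g.
exact: cabs2_ge0.
Qed.

Let le_sqr4 (a b c d : R) :
  `|a * c + b * d| <= a ^+ 2 + b ^+ 2 + (c ^+ 2 + d ^+ 2).
Proof.
have := sqr_ge0 (a - c); have := sqr_ge0 (b - d).
have := sqr_ge0 (a + c); have := sqr_ge0 (b + d).
have := sqr_ge0 a; have := sqr_ge0 b; have := sqr_ge0 c; have := sqr_ge0 d.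
by move=> *; rewrite ler_norml; apply/andP; split; nra.
Qed.

(** The products are dominated by the sum of the squares of the moduli. *)
Lemma summable_dot x y :
  summable [set: G] (EFin \o (fun g => complex.Re (x g * (y g)^*))) /\
  summable [set: G] (EFin \o (fun g => complex.Im (x g * (y g)^*))).
Proof.
have s := summableD (ell2_summable x) (ell2_summable y).
split; apply: le_summable s => g.
  rewrite /cabs2 conjcE; case: (x g) (y g) => a b [c d] /=.
  by rewrite mulrN opprK; exact: le_sqr4.
rewrite /cabs2 conjcE; case: (x g) (y g) => a b [c d] /=.
by have := le_sqr4 a b (- d) c; rewrite sqrrN [d ^+ 2 + _]addrC.
Qed.

Lemma ell2_dotDl x y z : ell2_dot (x + y) z = ell2_dot x z + ell2_dot y z.
Proof.
have [sr si] := summable_dot x z; have [tr ti] := summable_dot y z.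
rewrite /ell2_dot [RHS]/GRing.add /= -!rsumD//.
have E g : (x + y) g * (z g)^* = x g * (z g)^* + y g * (z g)^* :> C.
  by rewrite -mulrDl.
by congr Complex; congr rsum; apply/funext => g;
  rewrite E; case: (x g * _) => ? ?; case: (y g * _).
Qed.

Lemma ell2_dotZl c x z : ell2_dot (c *: x) z = c * ell2_dot x z.
Proof.
have [sr si] := summable_dot x z.
case: c => a b; rewrite /ell2_dot [RHS]/GRing.mul /= -!rsumZ//.
rewrite -rsumN; last exact: summable_EFinZ.
have E g : (Complex a b *: x) g * (z g)^* = Complex a b * (x g * (z g)^*) :> C.
  by rewrite mulrA.
rewrite -!rsumD; [|exact: summable_EFinZ..|]; last first.
  have := @summable_EFinZ R G (- b) _ si; congr summable; apply/funext => g /=.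
  by rewrite mulNr.
by congr Complex; congr rsum; apply/funext => g; rewrite E; case: (x g * _) => ? ? /=.
Qed.

Lemma ell2_dotC x y : ell2_dot y x = (ell2_dot x y)^*.
Proof.
have [sr si] := summable_dot x y.
rewrite conjcE /ell2_dot /= -rsumN//.
congr Complex; congr rsum; apply/funext => g.
  by rewrite !conjcE; case: (x g) => a b; case: (y g) => a' b' /=; ring.
by rewrite !conjcE; case: (x g) => a b; case: (y g) => a' b' /=; ring.
Qed.

Lemma ell2_dotDr x y z : ell2_dot x (y + z) = ell2_dot x y + ell2_dot x z.
Proof. by rewrite ell2_dotC ell2_dotDl rmorphD/= -!ell2_dotC. Qed.

Lemma ell2_dotZr c x z : ell2_dot x (c *: z) = c^* * ell2_dot x z.
Proof. by rewrite ell2_dotC ell2_dotZl rmorphM/= -!ell2_dotC. Qed.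

Lemma ell2_dotBl x y z : ell2_dot (x - y) z = ell2_dot x z - ell2_dot y z.
Proof. by rewrite -scaleN1r ell2_dotDl ell2_dotZl mulN1r. Qed.

Lemma ell2_dotBr x y z : ell2_dot x (y - z) = ell2_dot x y - ell2_dot x z.
Proof. by rewrite ell2_dotC ell2_dotBl rmorphB/= -!ell2_dotC. Qed.

Lemma ell2_dot_rho g x y : ell2_dot (rho g x) (rho g y) = ell2_dot x y.
Proof.
rewrite /ell2_dot -(rsum_shift g (fun h => complex.Re (x h * (y h)^*))).
by rewrite -(rsum_shift g (fun h => complex.Im (x h * (y h)^*))).
Qed.

Lemma ell2_dot_delta g x : ell2_dot x (delta R g) = x g.
Proof.
have E h : h != g -> x h * (delta R g h)^* = 0.
  by move=> /negPf hg; rewrite /= /delta_fun hg rmorph0 mulr0.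
rewrite /ell2_dot !(rsum1 (h := g)); last 2 first.
- by move=> h /E ->.
- by move=> h /E ->.
by rewrite /= /delta_fun eqxx rmorph1 mulr1; case: (x g).
Qed.

Lemma ell2_dotxx x : exists2 r : R, 0 <= r &
  ell2_dot x x = r%:C%C /\ forall g, cabs2 (x g) <= r.
Proof.
have E g : x g * (x g)^* = Complex (cabs2 (x g)) 0 :> C.
  rewrite conjcE /cabs2; case: (x g) => a b /=; rewrite [LHS]/GRing.mul /=.
  by congr Complex; ring.
exists (rsum (fun g => cabs2 (x g))).
  by apply: rsum_ge0 => g; exact: cabs2_ge0.
split.
  rewrite /ell2_dot; congr Complex; first by congr rsum; apply/funext => g; rewrite E.
  by rewrite (rsum1 (h := 0)) => [|g _]; rewrite E.
move=> g; apply: (@ler_rsum R G g (fun g => cabs2 (x g))); first exact: ell2_summable.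
by move=> h; exact: cabs2_ge0.
Qed.

Lemma ell2_dot_ge0 x : 0 <= ell2_dot x x.
Proof. by have [r r0 [-> _]] := ell2_dotxx x; rewrite lecE /= eqxx. Qed.

Lemma ell2_dot_gt0 x : x != 0 -> 0 < ell2_dot x x.
Proof.
rewrite lt_neqAle ell2_dot_ge0 andbT; apply: contra_neq => x0.
apply/val_inj/funext => g /=.
have [r r0 [E le]] := ell2_dotxx x.
have {E} r00 : r = 0 by move: x0; rewrite E => -[].
have := le g; rewrite r00 /cabs2; case: (x g) => a b /= h.
have [-> ->] : a = 0 /\ b = 0.
  have := sqr_ge0 a; have := sqr_ge0 b => b0 a0.
  by split; apply/eqP; rewrite -sqrf_eq0 eq_le sqr_ge0 andbT; lra.
by [].
Qed.

(** The inner products with the [delta R g] recover all coordinates, so at most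
    one map can be an adjoint of [F]. *)
Lemma adjoint_eq (F F' : ell2 R G -> ell2 R G) :
  (forall x y, ell2_dot (F x) y = ell2_dot x (F' y)) -> adjoint F = F'.
Proof.
move=> FF'; rewrite /adjoint; case: xgetP => [K _ /= FK|/(_ F')//].
apply/funext => y; apply/val_inj/funext => g.
have := FK (delta R g) y.
rewrite FF' (ell2_dotC (K y)) (ell2_dotC (F' y)) !ell2_dot_delta.
by move/(can_inj (@conjCK _)) => /= ->.
Qed.

Lemma rhoD g h x : rho g (rho h x) = rho (g + h) x.
Proof. by apply/val_inj/funext => k /=; rewrite [g + h]addrC addrA addrAC. Qed.

Lemma rho0 x : rho 0 x = x.
Proof. by apply/val_inj/funext => k /=; rewrite addr0. Qed.

Lemma rho_linear g : linear (@rho R G g).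
Proof. by move=> a x y; apply/val_inj. Qed.

Lemma adjoint_rho g : adjoint (@rho R G g) = rho (- g).
Proof.
apply: adjoint_eq => x y.
by rewrite -[in RHS](ell2_dot_rho g) rhoD subrr rho0.
Qed.

End Ell2Dot.

(** * A positive element of the span with nonzero trace norm *)

Section Laplacian.
Variables (R : realType) (G : zmodType).
Local Notation C := (Cplx R).
Implicit Types (x y : ell2 R G).

(** This is [(1 - rho g)^* (1 - rho g) = 2 - rho g - rho (- g)], the simplest
    positive element of the span whose image under the multiplier map vanishes
    where the character [Xchar g] takes the value 1. *)
Definition laplacian (g : G) (x : ell2 R G) : ell2 R G :=
  (x - rho g x) - rho (- g) (x - rho g x).

Lemma laplacian_dot g x y :
  ell2_dot (laplacian g x) y = ell2_dot (x - rho g x) (y - rho g y).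
Proof.
rewrite /laplacian ell2_dotBl ell2_dotBr.
by rewrite -[in X in _ = _ - X](ell2_dot_rho (- g)) rhoD addNr rho0.
Qed.

Lemma laplacian_adjoint g : adjoint (laplacian g) = laplacian g.
Proof.
apply: adjoint_eq => x y.
by rewrite laplacian_dot ell2_dotC -laplacian_dot -ell2_dotC.
Qed.

Lemma laplacian_positive g : positive_op (laplacian g).
Proof. by move=> x; rewrite laplacian_dot ell2_dot_ge0. Qed.

Let ell2_dotB_le x y :
  ell2_dot (x - y) (x - y) <= 2 * ell2_dot x x + 2 * ell2_dot y y.
Proof.
rewrite -subr_ge0; apply: (le_trans (ell2_dot_ge0 (x + y))).
rewrite !(ell2_dotBl, ell2_dotBr) !(ell2_dotDl, ell2_dotDr).
rewrite le_eqVlt; apply/orP; left; apply/eqP; ring.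
Qed.

Lemma laplacian_bounded g : bounded_op (laplacian g).
Proof.
split=> [a x y|].
  apply/val_inj/funext => k.
  suff E : laplacian g (a *: x + y) = a *: laplacian g x + laplacian g y by rewrite E.
  rewrite /laplacian; have lin := rho_linear (R := R) (G := G).
  have E : a *: x + y - rho g (a *: x + y) = a *: (x - rho g x) + (y - rho g y).
    by rewrite lin opprD addrACA -scalerN -scalerDr.
  by rewrite E (lin (- g)) opprD addrACA -scalerN -scalerDr.
exists 16 => x.
have B (h : G) (z : ell2 R G) :
    ell2_dot (z - rho h z) (z - rho h z) <= 4 * ell2_dot z z.
  apply: le_trans (ell2_dotB_le _ _) _; rewrite ell2_dot_rho -mulrDl.
  by rewrite le_eqVlt; apply/orP; left; apply/eqP; ring.
apply: le_trans (B _ _) _; rewrite (_ : 16 = 4 * 4); last by ring.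
by rewrite -mulrA ler_pM2l ?ltr0n.
Qed.

Lemma laplacian_span g :
  laplacian g = 2 *: rho 0 + (- 1 *: rho g + - 1 *: rho (- g)) :> (ell2 R G -> ell2 R G).
Proof.
apply/funext => x; rewrite /laplacian.
change (x - rho g x - rho (- g) (x - rho g x) =
  2 *: rho 0 x + (- 1 *: rho g x + - 1 *: rho (- g) x)).
have -> : rho (- g) (x - rho g x) = rho (- g) x - x.
  by rewrite -[X in _ = _ - X]rho0 -(addNr g) -rhoD; apply/val_inj.
by rewrite rho0 !scaleN1r scaler_nat mulr2n opprB addrACA.
Qed.

(** Since the Laplacian [P] is positive, it is itself a positive square root of
    [P^* P], so [abs_op] does return some positive [Q] with [Q^2 = P^2].  If the trace of [Q] were 0,
    then, with [d] the delta at 0 and [q = Q d], positivity of [Q] at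
    [t q + d] would read [0 <= t (|q|^2 + |P d|^2) + t^2 <Q q, q>] for all real
    [t], which fails for small negative [t] because [P d != 0]. *)
Lemma trace_norm_laplacian (g : G) : g != 0 -> trace_norm (laplacian g) != 0.
Proof.
move=> g0; rewrite /trace_norm /abs_op.
case: xgetP => [Q _ [[linQ _] posQ QQ]|/(_ (laplacian g))[]]; last first.
  split; [exact: laplacian_bounded|exact: laplacian_positive|].
  by rewrite laplacian_adjoint.
rewrite laplacian_adjoint in QQ.
rewrite /tau; set d := delta R 0; set q := Q d.
apply/eqP => qd0.
have QqE : ell2_dot (Q q) d = ell2_dot (laplacian g d) (laplacian g d).
  have -> : Q q = laplacian g (laplacian g d) by rewrite -[RHS]/((laplacian g \o _) d) -QQ.
  by rewrite laplacian_dot ell2_dotC -laplacian_dot -ell2_dotC.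
have N0 : 0 < ell2_dot (laplacian g d) (laplacian g d).
  apply: ell2_dot_gt0; apply/eqP => /(congr1 (fun f : ell2 R G => f 0)).
  have -> : laplacian g d 0 = (0 == 0 :> G)%:R - (0 + g == 0)%:R -
      ((0 - g == 0)%:R - (0 - g + g == 0)%:R) by [].
  rewrite !add0r oppr_eq0 addNr eqxx (negPf g0) !subr0 sub0r opprK.
  change (1 + 1 = 0 :> C -> False).
  by move/eqP; rewrite -(natrD _ 1 1) pnatr_eq0.
set N := ell2_dot _ _ in N0 QqE.
set k := ell2_dot (Q q) q; have k0 : 0 <= k by exact: posQ.
set s := ell2_dot q q + N; have s0 : 0 < s by rewrite ltr_wpDl// ell2_dot_ge0.
have ks0 : 0 < k + s by rewrite ltr_wpDl.
(* The value at this [t] is [- s^3 / (k + s)^2], which is negative. *)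
pose t := - (s / (k + s)).
have tR : t^* = t by rewrite conj_Creal// realN ger0_real// divr_ge0// ltW.
have := posQ (t *: q + d).
rewrite linQ -/q !(ell2_dotDl, ell2_dotZl) !(ell2_dotDr, ell2_dotZr).
rewrite qd0 tR QqE -/k.
rewrite (_ : _ + _ = - (s ^+ 3 / (k + s) ^+ 2)).
  by rewrite oppr_ge0 => /le_gtF; rewrite divr_gt0// exprn_gt0.
rewrite /t; have -> : ell2_dot q q = s - N by rewrite /s addrK.
by field; rewrite gt_eqF.
Qed.
End Laplacian.

(** * Real and imaginary parts of complex numbers *)

Section ComplexParts.
Variable R : realType.
Local Notation C := (Cplx R).
Implicit Types z : C.

Lemma normCE z : `|z| = Complex (Num.sqrt (cabs2 z)) 0 :> C.
Proof. exact: (normc_def (z : R[i])). Qed.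

Lemma ler_norm_Re z : `|complex.Re z| <= Num.sqrt (cabs2 z).
Proof. by rewrite -sqrtr_sqr ler_wsqrtr// /cabs2 lerDl sqr_ge0. Qed.

Lemma ler_norm_Im z : `|complex.Im z| <= Num.sqrt (cabs2 z).
Proof. by rewrite -sqrtr_sqr ler_wsqrtr// /cabs2 lerDr sqr_ge0. Qed.

Lemma ler_cabs2 z :
  Num.sqrt (cabs2 z) <= `|complex.Re z| + `|complex.Im z|.
Proof.
rewrite -[leRHS]ger0_norm ?addr_ge0// -[leRHS]sqrtr_sqr ler_wsqrtr//.
rewrite /cabs2 sqrrD !real_normK ?num_real//.
by rewrite addrAC lerDl mulrn_wge0// mulr_ge0.
Qed.

Lemma Re_continuous : continuous (@complex.Re R : C -> R).
Proof.
move=> z; have FF := @nbhs_filter C z; apply/(@cvgrPdist_lt _ _ _ (nbhs z)) => e e0.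
have : (e%:C)%C > 0 :> C by rewrite ltcE /= eqxx.
move=> /(nbhsx_ballx z) /filterS; apply => w.
rewrite -ball_normE /= normCE ltcE /= eqxx /=.
by apply: le_lt_trans; apply: le_trans (ler_norm_Re _); case: z {FF} w => a b [].
Qed.

Lemma Im_continuous : continuous (@complex.Im R : C -> R).
Proof.
move=> z; have FF := @nbhs_filter C z; apply/(@cvgrPdist_lt _ _ _ (nbhs z)) => e e0.
have : (e%:C)%C > 0 :> C by rewrite ltcE /= eqxx.
move=> /(nbhsx_ballx z) /filterS; apply => w.
rewrite -ball_normE /= normCE ltcE /= eqxx /=.
by apply: le_lt_trans; apply: le_trans (ler_norm_Im _); case: z {FF} w => a b [].
Qed.

End ComplexParts.

(** * Borel sets of the dual group *)

Section DualBorel.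
Variables (R : realType) (G : zmodType).
Local Notation C := (Cplx R).
Local Notation dual := (dual R G).
Local Notation character := (character R G).

(** The boolean selects the imaginary part; this lets the real and the imaginary
    parts of characters be indexed together. *)
Definition cpart (b : bool) (z : C) : R :=
  if b then complex.Im z else complex.Re z.

Definition chpart (b : bool) (g : G) (a : dual) : R := cpart b (Xchar g a).

Lemma cpart_continuous b : continuous (cpart b).
Proof. by case: b; [exact: Im_continuous|exact: Re_continuous]. Qed.

Lemma eval_continuous (g : G) : continuous (fun a : character => (a g : C)).
Proof.
move=> a.
have /= h := @initial_continuous character _
  (@character_val R G : character -> {ptws G -> C}) a.
have k := @proj_continuous G (fun _ => C : topologicalType) g (character_val a).
exact: (@continuous_comp character {ptws G -> C} C _ _ a h k).
Qed.

Lemma measurable_chpart b g : measurable_fun setT (chpart b g).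
Proof.
apply: (measurability _ (measurable_realfun.RGenOpens.measurableE R)).
move=> _ [_ [x [y ->]] <-]; rewrite setTI.
apply: sub_sigma_algebra.
have /continuousP : continuous (fun a : character => cpart b (a g)).
  move=> a; apply: (@continuous_comp character C R _ _ a (@eval_continuous g a)).
  exact: cpart_continuous.
by apply; exact: interval_open.
Qed.

Lemma chpart_le1 b g a : `|chpart b g a| <= 1.
Proof.
have := @character_unit _ _ (a : character) g.
rewrite normCE => -[E]; rewrite -E /chpart /cpart.
by case: b; [exact: ler_norm_Im|exact: ler_norm_Re].
Qed.

Definition hsign (s : bool) (x : R) : R := if s then - x else x.

(** A quadruple [(g, b, s, q)] encodes the open half space where plus or minus
    (according to [s]) the part [b] of the value at [g] is less than [q];
    rational bounds keep the half spaces countable. *)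
Definition half (c : G * bool * bool * rat) (f : G -> C) : Prop :=
  hsign c.1.2 (cpart c.1.1.2 (f c.1.1.1)) < ratr c.2.

Definition half_space (c : G * bool * bool * rat) : set dual :=
  [set a | half c (character_val (a : character))].

Definition fbox (L : seq (G * bool * bool * rat)) : set (G -> C) :=
  [set f | forall c, c \in L -> half c f].

Definition box (L : seq (G * bool * bool * rat)) : set dual :=
  [set a | fbox L (character_val (a : character))].

Lemma fbox_cat L L' : fbox (L ++ L') = fbox L `&` fbox L'.
Proof.
apply/seteqP; split=> [f h|f [h k] c]; last first.
  by rewrite mem_cat => /orP[/h|/k].
by split=> c cL; apply: h; rewrite mem_cat cL ?orbT.
Qed.

Lemma box_cat L L' : box (L ++ L') = box L `&` box L'.
Proof. by rewrite /box fbox_cat. Qed.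

(** The boxes around [a] generate a filter which converges pointwise to [a],
    hence in the topology of pointwise convergence; an open set containing [a]
    belongs to it. *)
Lemma open_sub_box (O : set character) (a : character) : open O -> O a ->
  exists2 L, box L a & box L `<=` O.
Proof.
case=> A oA <- Aa.
pose F := filter_from [set L | box L a] fbox.
have FF : Filter F.
  apply: filter_from_filter; first by exists [::].
  by move=> L L' aL aL'; exists (L ++ L'); rewrite ?fbox_cat//= box_cat.
have : {ptws, F --> (a : G -> C)}.
  apply/(@pointwise_cvgP (discrete_topology G) C F) => g.
  apply/(@cvgrPdist_lt _ _ _ F) => e.
  case: e => r i; rewrite ltcE /= => /andP[/eqP -> r0].
  have r20 : 0 < r / 2 by rewrite divr_gt0.
  have near b s : exists q : rat,
      hsign s (cpart b (a g)) < ratr q < hsign s (cpart b (a g)) + r / 2.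
    have [q] : exists q : rat, ratr q \in
        `](hsign s (cpart b (a g))), (hsign s (cpart b (a g)) + r / 2)[.
      by apply: rat_in_itvoo; rewrite ltrDl.
    by rewrite in_itv /= => ?; exists q.
  have [q1 /andP[a1 b1]] := near false false.
  have [q2 /andP[a2 b2]] := near false true.
  have [q3 /andP[a3 b3]] := near true false.
  have [q4 /andP[a4 b4]] := near true true.
  exists [:: (g, false, false, q1); (g, false, true, q2);
             (g, true, false, q3); (g, true, true, q4)].
    by move=> c; rewrite !inE => /or4P[] /eqP ->.
  move=> f fL /=.
  have := fL (g, false, false, q1); have := fL (g, false, true, q2).
  have := fL (g, true, false, q3); have := fL (g, true, true, q4).
  rewrite !inE !eqxx ?orbT /half /= => /(_ isT) c4 /(_ isT) c3 /(_ isT) c2 /(_ isT) c1.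
  rewrite normCE ltcE /= eqxx /=; apply: le_lt_trans (ler_cabs2 _) _.
  rewrite /hsign /cpart /= in a1 a2 a3 a4 b1 b2 b3 b4 c1 c2 c3 c4.
  case: (a g) (f g) a1 a2 a3 a4 b1 b2 b3 b4 c1 c2 c3 c4 => x y [x' y'] /= *.
  have h1 : `|x - x'| < r / 2 by rewrite ltr_norml; apply/andP; split; lra.
  have h2 : `|y - y'| < r / 2 by rewrite ltr_norml; apply/andP; split; lra.
  by rewrite [ltRHS]splitr ltrD.
move=> cvF; have [L aL LA] : F A by apply: cvF; exact: open_nbhs_nbhs.
by exists L => // b /LA.
Qed.

Hypothesis G_countable : countable [set: G].

Lemma countable_constraints : countable [set: seq (G * bool * bool * rat)].
Proof.
have /countable_injP[f finj] := G_countable.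
pose h (c : G * bool * bool * rat) := (f c.1.1.1, c.1.1.2, c.1.2, c.2).
have hinj : injective h.
  move=> [[[g b] s] q] [[[g' b'] s'] q'] [] /= fg -> -> ->.
  by rewrite (finj g g' _ _ fg) ?inE.
apply/countable_injP; exists (fun L => choice.pickle (map h L)) => L L' _ _.
by move=> /(pcan_inj choice.pickleK) /(inj_map hinj).
Qed.

Lemma measurable_half c : measurable (half_space c).
Proof.
have := measurable_chpart c.1.1.2 c.1.1.1.
case: c => [[[g b] s] q] /= mf.
have -> : half_space (g, b, s, q) =
   (fun a => hsign s (chpart b g a)) @^-1` `]-oo, (ratr q)[.
  by apply/seteqP; split => a; rewrite /= in_itv.
rewrite -[X in measurable X]setTI.
have : measurable_fun setT (fun a => hsign s (chpart b g a)).
  by rewrite /hsign; case: s => //; exact: measurableT_comp.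
apply=> //; exact: measurable_itv.
Qed.

Lemma box_nil : box [::] = setT.
Proof. by apply/seteqP; split. Qed.

Lemma box_cons c L :
  box (c :: L) = half_space c `&` box L.
Proof.
apply/seteqP; split=> [a h|a [h k] c'].
  split; first by apply: h; rewrite inE eqxx.
  by move=> c' c'L; apply: h; rewrite inE c'L orbT.
by rewrite inE => /orP[/eqP ->//|/k].
Qed.

Lemma measurable_box L : measurable (box L).
Proof.
elim: L => [|c L IH]; first by rewrite box_nil.
by rewrite box_cons; apply: measurableI => //; exact: measurable_half.
Qed.

(** The boxes form a countable base of the topology of the dual. *)
Lemma dual_measurableE :
  (@measurable _ dual) = <<s [set box L | L in setT] >>.
Proof.
apply/seteqP; split.
  apply: smallest_sub; first exact: smallest_sigma_algebra.
  move=> O oO.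
  have -> : O = \bigcup_(L in [set: seq (G * bool * bool * rat)])
      (if `[< box L `<=` O >] then box L else set0).
    apply/seteqP; split=> [a Oa|a [L _]]; last by case: asboolP => // LO /LO.
    have [L aL LO] := open_sub_box oO Oa.
    by exists L => //; case: asboolP.
  apply: (@countable_bigcupT_measurable _ (g_sigma_algebraType [set box L | L in setT])
    _ _ countable_constraints) => L.
  case: ifP => _; last exact: measurable0.
  by apply: sub_sigma_algebra; exists L.
apply: smallest_sub; first exact: sigma_algebra_measurable.
by move=> _ [L _ <-]; exact: measurable_box.
Qed.

End DualBorel.

(** * Polynomial approximation of the indicator of a half line *)

Section Step.
Variable R : realType.
Implicit Types t x y : R.

Lemma bernoulli_ineq x n : -1 <= x -> 1 + n%:R * x <= (1 + x) ^+ n.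
Proof.
move=> x1; elim: n => [|n IH]; first by rewrite mul0r addr0 expr0.
rewrite exprS; apply: (@le_trans _ _ ((1 + x) * (1 + n%:R * x))); last first.
  by rewrite ler_wpM2l// -lerBlDl sub0r.
rewrite -natr1 -subr_ge0 [leRHS](_ : _ = n%:R * x ^+ 2); last by ring.
by rewrite mulr_ge0// sqr_ge0.
Qed.

(** On [0, 1] these polynomials converge pointwise to the indicator of
    [t < 1/2].  The exponent is such that its product with [t ^+ n] is
    [n (2 t)^n], which tends to 0 for [t < 1/2] and is at least [n] otherwise;
    Bernoulli's inequality does the rest. *)
Definition step n t := (1 - t ^+ n) ^+ (n * 2 ^ n).

Lemma step_bound n t : 0 <= t <= 1 -> 0 <= step n t <= 1.
Proof.
move=> /andP[t0 t1]; have h : 0 <= 1 - t ^+ n <= 1.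
  by rewrite subr_ge0 exprn_ile1//= lerBlDr lerDl exprn_ge0.
by case/andP: h => h0 h1; rewrite /step exprn_ge0//= exprn_ile1.
Qed.

(** With [s] the square root of [r], [n s^n] is bounded by [1 / (1 - s)], by
    Bernoulli's inequality applied to [(1 + (1 - s))^n]. *)
Let natpow_cvg0 (r : R) : 0 <= r < 1 -> (fun n => n%:R * r ^+ n) @ \oo --> (0 : R).
Proof.
move=> /andP[r0 r1]; pose s := Num.sqrt r.
have s0 : 0 <= s by exact: sqrtr_ge0.
have s1 : s < 1 by rewrite -sqrtr1 ltr_sqrt.
have rE n : r ^+ n = s ^+ n * s ^+ n.
  by rewrite -exprMn -expr2 sqr_sqrtr.
have le n : n%:R * s ^+ n <= (1 - s)^-1.
  rewrite -[leRHS]mul1r ler_pdivlMr ?subr_gt0//.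
  have s2 : -1 <= 1 - s by lra.
  move: (bernoulli_ineq n s2) => /(ler_wpM2l (exprn_ge0 n s0)); rewrite -exprMn.
  have : (s * (1 + (1 - s))) ^+ n <= 1.
    have -> : s * (1 + (1 - s)) = 1 - (1 - s) ^+ 2 by ring.
    by rewrite exprn_ile1//; nra.
  move=> h k; have := le_trans k h; apply: le_trans.
  rewrite -subr_ge0 [leRHS](_ : _ = s ^+ n) ?exprn_ge0//; ring.
have cs : (fun n => (1 - s)^-1 * s ^+ n) @ \oo --> (0 : R).
  rewrite -[X in _ --> X](mulr0 (1 - s)^-1); apply: cvgM; first exact: cvg_cst.
  by apply: cvg_expr; rewrite ger0_norm.
apply: squeeze_cvgr (cvg_cst 0) cs; apply: nearW => n.
rewrite mulr_ge0 ?exprn_ge0//= rE mulrA ler_wpM2r ?exprn_ge0//.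
Qed.

Lemma cvg_step t : 0 <= t <= 1 -> (fun n => step n t) @ \oo --> ((t < 2^-1)%R%:R : R).
Proof.
move=> /andP[t0 t1]; have [t2|t2] := ltP t 2^-1.
  have r1 : 0 <= 2 * t < 1 by rewrite mulr_ge0//= -ltr_pdivlMl// mulr1.
  have cvg1 : (fun n => 1 - n%:R * (2 * t) ^+ n) @ \oo --> (1 : R).
    rewrite -[X in _ --> X]subr0; apply: cvgB; first exact: cvg_cst.
    exact: natpow_cvg0.
  have -> : true%:R = 1 :> R by [].
  have c1 : (fun n : nat => 1) @ \oo --> (1 : R) by exact: cvg_cst.
  apply: (squeeze_cvgr _ cvg1 c1); apply: nearW => n.
  have /andP[_ ->] : 0 <= step n t <= 1 by apply: step_bound; rewrite t0.
  rewrite andbT /step; have := @bernoulli_ineq (- t ^+ n) (n * 2 ^ n).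
  rewrite lerN2 exprn_ile1// => /(_ isT); apply: le_trans.
  by rewrite natrM natrX exprMn mulrN mulrA.
have cvg0 : (fun n => n.+1%:R^-1) @ \oo --> (0 : R) by exact: cvg_harmonic.
have -> : false%:R = 0 :> R by [].
have c0 : (fun n : nat => 0) @ \oo --> (0 : R) by exact: cvg_cst.
apply: (squeeze_cvgr _ c0 cvg0); apply: nearW => n.
have tn0 : 0 <= t ^+ n by exact: exprn_ge0.
have /andP[-> _ /=] : 0 <= step n t <= 1 by apply: step_bound; rewrite t0.
have := @bernoulli_ineq (t ^+ n) (n * 2 ^ n).
rewrite (le_trans _ tn0) ?lerN10// => /(_ isT) h.
(* The product of [step n t] with this power is at most 1, as
   [(1 - y) (1 + y) = 1 - y ^+ 2]. *)
have n1 : n.+1%:R <= (1 + t ^+ n) ^+ (n * 2 ^ n).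
  apply: le_trans h; rewrite -natr1 addrC lerD2l natrM natrX -mulrA -exprMn.
  rewrite ler_peMr// exprn_ege1// -ler_pdivrMl// mulr1//.
rewrite -[leRHS]mul1r ler_pdivlMr ?ltr0n//.
have /andP[st0 _] : 0 <= step n t <= 1 by apply: step_bound; rewrite t0.
apply: le_trans (ler_wpM2l st0 n1) _; rewrite /step -exprMn.
rewrite -subr_sqr expr1n exprn_ile1//.
  by rewrite subr_ge0 !exprn_ile1.
by rewrite lerBlDr lerDl sqr_ge0.
Qed.

End Step.

(** * Integrable functions orthogonal to all characters *)

Section IntegrableTools.
Context d (T : measurableType d) (R : realType) (m : {measure set T -> \bar R}).
Implicit Types u v h : T -> R.

Lemma integrable_measurable u :
  m.-integrable setT (EFin \o u) -> measurable_fun setT u.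
Proof. by move=> /measurable_int /measurable_EFinP. Qed.

Lemma integrableM_bounded u h (M : R) : m.-integrable setT (EFin \o u) ->
  measurable_fun setT h -> (forall x, `|h x| <= M) ->
  m.-integrable setT (EFin \o (fun x => u x * h x)).
Proof.
move=> iu mh hM.
apply: (@le_integrable _ _ _ m setT measurableT _ (fun x => M%:E * (u x)%:E)%E).
- apply/measurable_EFinP; apply: measurable_funM => //.
  exact: integrable_measurable.
- move=> x _; rewrite -EFinM lee_fin /= !normrM mulrC.
  by rewrite ler_wpM2r// (le_trans (hM x))// ler_norm.
- exact: integrableZl.
Qed.

Lemma integrable_lincomb u v (p q : R) : m.-integrable setT (EFin \o u) ->
  m.-integrable setT (EFin \o v) ->
  m.-integrable setT (EFin \o (fun x => p * u x + q * v x)).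
Proof.
move=> iu iv; have -> : EFin \o (fun x => p * u x + q * v x) =
    ((fun x => p%:E * (u x)%:E) \+ (fun x => q%:E * (v x)%:E))%E.
  by apply/funext => x /=; rewrite EFinD !EFinM.
by apply: integrableD => //; apply: integrableZl.
Qed.

Lemma Rintegral_lincomb u v (p q : R) : m.-integrable setT (EFin \o u) ->
  m.-integrable setT (EFin \o v) ->
  (\int[m]_x (p * u x + q * v x) = p * \int[m]_x u x + q * \int[m]_x v x)%R.
Proof.
move=> iu iv; rewrite RintegralD//; last 2 first.
- by have := integrableZl measurableT p iu; apply: eq_integrable => // x _.
- by have := integrableZl measurableT q iv; apply: eq_integrable => // x _.
by rewrite !RintegralZl.
Qed.

Lemma Rintegral_ext u v : (forall x, u x = v x) -> (\int[m]_x u x = \int[m]_x v x)%R.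
Proof. by move=> uv; apply: eq_Rintegral => x _; exact: uv. Qed.

End IntegrableTools.

Section FourierNull.
Variables (R : realType) (G : zmodType).
Variable m : {measure set (dual R G) -> \bar R}.
Local Notation dual := (dual R G).
Local Notation chpart := (@chpart R G).
Implicit Types u v : dual -> R.

(** For real [u] this says that all Fourier coefficients vanish; every function
    [h] for which [u * h] inherits the property is a multiplier, and the lemmas
    below enlarge the set of multipliers up to all indicators of Borel sets. *)
Definition fourier_null u : Prop := m.-integrable setT (EFin \o u) /\
  forall b g, (\int[m]_a (u a * chpart b g a) = 0)%R.

Lemma integrable_chpart u b g : m.-integrable setT (EFin \o u) ->
  m.-integrable setT (EFin \o (fun a => u a * chpart b g a)).
Proof.
move=> iu; apply: (integrableM_bounded (M := 1)) => //.
  exact: measurable_chpart.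
exact: chpart_le1.
Qed.

Lemma fourier_null_lincomb u v (p q : R) : fourier_null u -> fourier_null v ->
  fourier_null (fun a => p * u a + q * v a).
Proof.
move=> [iu ou] [iv ov]; split; first exact: integrable_lincomb.
move=> b g; rewrite (@Rintegral_ext _ _ _ m _ (fun a => p * (u a * chpart b g a) +
    q * (v a * chpart b g a))); last by move=> a; ring.
by rewrite Rintegral_lincomb ?ou ?ov ?mulr0 ?addr0//; exact: integrable_chpart.
Qed.

Lemma character0 (a : character R G) : a 0 = 1.
Proof.
have a0 : a 0 != 0 by rewrite -normr_eq0 character_unit oner_eq0.
by apply: (mulfI a0); rewrite -characterD addr0 mulr1.
Qed.

Lemma characterN (a : character R G) g : a (- g) = (a g)^*.
Proof.
have ag : a g != 0 by rewrite -normr_eq0 character_unit oner_eq0.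
apply: (mulfI ag); rewrite -characterD subrr character0.
by rewrite -normCK character_unit expr1n.
Qed.

(** Product-to-sum formulas, from [2 Re z Re w = Re (z w) + Re (z w^* )] and its
    three companions. *)
Lemma chpartM b g b' h : exists (p q : R) c, forall a,
  chpart b g a * chpart b' h a = p * chpart c (g + h) a + q * chpart c (g - h) a.
Proof.
have E (a : dual) : Xchar (g + h) a = Xchar g a * Xchar h a.
  exact: characterD.
have F (a : dual) : Xchar (g - h) a = Xchar g a * (Xchar h a)^*.
  by rewrite /Xchar characterD characterN.
pose c := xorb b b'; pose p : R := (if b && b' then - 2^-1 else 2^-1).
pose q : R := if ~~ b && b' then - 2^-1 else 2^-1.
exists p, q, c => a; rewrite /chpart E F conjcE.
rewrite /p /q /c /cpart {p q c}; case: (Xchar g a) => x y; case: (Xchar h a) => x' y'.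
by case: b; case: b' => /=; field.
Qed.

Lemma fourier_null_chpart u b g : fourier_null u ->
  fourier_null (fun a => u a * chpart b g a).
Proof.
move=> [iu ou]; split; first exact: integrable_chpart.
move=> b' h; have [p [q [c E]]] := chpartM b g b' h.
rewrite (@Rintegral_ext _ _ _ m _ (fun a => p * (u a * chpart c (g + h) a) +
   q * (u a * chpart c (g - h) a))).
  by rewrite Rintegral_lincomb ?ou ?mulr0 ?addr0//; exact: integrable_chpart.
by move=> a; rewrite -mulrA E; ring.
Qed.

Lemma eq_orth u v : (forall a, u a = v a) -> fourier_null u -> fourier_null v.
Proof. by move=> uv; have -> : u = v by apply/funext. Qed.

Lemma fourier_null_poly u b g (p : {poly R}) : fourier_null u ->
  fourier_null (fun a => u a * p.[chpart b g a]).
Proof.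
move=> ou; elim/poly_ind: p => [|p c IH].
  apply: eq_orth (fourier_null_lincomb 0 0 ou ou) => a.
  by rewrite horner0 mulr0 !mul0r addr0.
apply: eq_orth (fourier_null_lincomb 1 c (fourier_null_chpart b g IH) ou) => a.
by rewrite !hornerE; ring.
Qed.

Lemma fourier_null_lim u (h_ : nat -> dual -> R) (h : dual -> R) :
  m.-integrable setT (EFin \o u) ->
  (forall n, fourier_null (fun a => u a * h_ n a)) ->
  (forall n a, `|h_ n a| <= 1) ->
  measurable_fun setT h ->
  (forall a, (fun n => h_ n a) @ \oo --> h a) ->
  fourier_null (fun a => u a * h a).
Proof.
move=> iu oh le1 mh ch.
have h1 a : `|h a| <= 1.
  have cn : (fun n => `|h_ n a|) @ \oo --> `|h a|.
    by apply: cvg_norm; exact: ch.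
  rewrite -(cvg_lim _ cn)//; apply: limr_le; first by apply/cvg_ex; exists `|h a|.
  exact: nearW.
split; first exact: (integrableM_bounded iu mh h1).
move=> b g; have ic := integrable_chpart b g iu.
have i0 n : (\int[m]_a (u a * h_ n a * chpart b g a)%:E = 0)%E.
  have [ih oh0] := oh n; rewrite -[RHS]/(0%:E) -(oh0 b g) /Rintegral fineK//.
  by apply: integrable_fin_num => //; exact: integrable_chpart.
have [] := @dominated_convergence _ _ _ m setT measurableT
  (fun n a => (u a * h_ n a * chpart b g a)%:E) (fun a => (u a * h a * chpart b g a)%:E)
  (fun a => `|(u a)%:E|)%E.
- move=> n; apply/measurable_EFinP; apply: integrable_measurable.
  by have [ih _] := oh n; exact: (integrable_chpart b g ih).
- apply/measurable_EFinP; apply: integrable_measurable.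
  exact/integrable_chpart/(integrableM_bounded iu mh h1).
- apply: aeW => a _; apply/cvg_EFin; first exact: nearW.
  apply: cvgM; last exact: cvg_cst.
  by apply: cvgM; [exact: cvg_cst|exact: ch].
- exact: integrable_abse.
- apply: aeW => a n _; rewrite /= lee_fin !normrM -mulrA ler_piMr//.
  by rewrite mulr_ile1// chpart_le1.
move=> _ _ cv; rewrite /Rintegral.
move: cv; rewrite (_ : [sequence _]_n = cst 0%E); last by apply/funext => n; exact: i0.
by move/cvg_lim => <- //; rewrite lim_cst.
Qed.

(** The affine map [t] sends the range of the part [b] of [Xchar g] into [0, 1]
    and the bound [q] to 1/2, where the polynomials [step] cut. *)
Lemma fourier_null_half u c : fourier_null u ->
  fourier_null (fun a => u a * \1_(half_space c) a).
Proof.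
case: c => [[[g b] s] q] ou; set x := ratr q : R.
pose k : R := (2 * (1 + `|x|))^-1.
have k0 : 0 < k by rewrite invr_gt0 mulr_gt0// ltr_wpDr.
pose e : R := if s then - k else k.
pose P : {poly R} := e *: 'X + (2^-1 - k * x)%:P.
pose t a : R := 2^-1 + k * (hsign s (chpart b g a) - x).
have Pt a : P.[chpart b g a] = t a.
  by rewrite /P /t hornerD hornerZ hornerX hornerC /e /hsign; case: (s); ring.
have t01 a : 0 <= t a <= 1.
  have := chpart_le1 b g a; rewrite /t; set y := hsign _ _.
  have -> : `|chpart b g a| = `|y| by rewrite /y /hsign; case: (s); rewrite ?normrN.
  move=> y1; have : `|k * (y - x)| <= 2^-1.
    rewrite normrM gtr0_norm// /k invfM -mulrA ger_pMr ?invr_gt0//.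
    rewrite ler_pdivrMl ?ltr_wpDr// mulr1 (le_trans (ler_normB _ _))//.
    by rewrite lerD2r.
  by rewrite ler_norml => /andP[? ?]; apply/andP; split; lra.
apply: (@fourier_null_lim _ (fun n a => step n (t a))).
- by case: ou.
- move=> n; apply: eq_orth (fourier_null_poly b g ((1 - P ^+ n) ^+ (n * 2 ^ n)) ou) => a.
  by rewrite horner_exp hornerD hornerN horner_exp Pt hornerC.
- by move=> n a; have /andP[? ?] := step_bound n (t01 a); rewrite ger0_norm.
- by apply: measurable_indic; exact: measurable_half.
- move=> a; have := cvg_step (t01 a).
  have -> // : (t a < 2^-1)%R%:R = \1_(half_space (g, b, s, q)) a :> R.
  rewrite indicE; congr (_ %:R); congr nat_of_bool.
  rewrite /t gtrDl pmulr_rlt0// subr_lt0.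
  by apply/idP/idP => [h|]; [apply/mem_set|move/set_mem].
Qed.

Lemma fourier_null_box u L : fourier_null u -> fourier_null (fun a => u a * \1_(box L) a).
Proof.
move=> ou; elim: L => [|c L IH].
  by apply: eq_orth ou => a; rewrite box_nil indicT mulr1.
apply: eq_orth (fourier_null_half c IH) => a.
by rewrite box_cons indicI /= -mulrA [X in _ * X = _]mulrC.
Qed.

Hypothesis G_countable : countable [set: G].

(** Dynkin's lemma on the pi-system of boxes; for a disjoint union, the
    indicators of the finite unions converge to that of the whole. *)
Lemma fourier_null_measurable u A : fourier_null u -> measurable A ->
  fourier_null (fun a => u a * \1_A a).
Proof.
move=> ou mA; have iu : m.-integrable setT (EFin \o u) by case: ou.
have dE := dual_measurableE R G_countable.
move: mA; rewrite {1}dE; move: A.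
apply: (@dynkin_induction _ dual [set box L | L in setT]
  (fun A => fourier_null (fun a => u a * \1_A a)) dE).
- by move=> _ _ [L _ <-] [L' _ <-]; exists (L ++ L'); rewrite ?box_cat.
- by apply: eq_orth ou => a; rewrite indicT mulr1.
- by move=> _ [L _ <-]; exact: fourier_null_box.
- move=> S mS oS; apply: eq_orth (fourier_null_lincomb 1 (- 1) ou oS) => a.
  rewrite !indicE in_setC; case: (_ \in _) => /=; ring.
move=> F mF tF oF.
pose S n := \bigcup_(i in `I_n) F i.
have mS n : measurable (S n) by apply: bigcup_measurable => i _.
have SF n a : S n a -> F n a -> False.
  move=> [i /= ilt Fia] Fna; have := tF i n I I; rewrite /disj_set.
  by move=> /(_ (ex_intro _ a (conj Fia Fna))) ie; rewrite ie ltnn in ilt.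
have SS n a : S n.+1 a <-> S n a \/ F n a.
  split=> [[i /=]|[[i /= ilt Fia]|Fna]].
  - by rewrite ltnS leq_eqVlt => /orP[/eqP ->|ilt] Fia; [right|left; exists i].
  - by exists i => //=; rewrite ltnS ltnW.
  - by exists n => /=.
apply: (@fourier_null_lim _ (fun n => \1_(S n))) => //.
- elim=> [|n IH].
    apply: eq_orth (fourier_null_lincomb 0 0 ou ou) => a.
    have -> : S 0 = set0 by apply/seteqP; split=> // b [].
    by rewrite indic0 mulr0 !mul0r addr0.
  apply: eq_orth (fourier_null_lincomb 1 1 IH (oF n)) => a.
  rewrite !mul1r -mulrDr !indicE; congr (_ * _).
  have [Fa|Fa] := pselect (F n a).
    rewrite (mem_set Fa) memNset ?mem_set ?add0r//; first by apply/SS; right.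
    by move=> /SF; apply.
  rewrite [in X in _ + X = _]memNset// addr0; congr (_ %:R); congr nat_of_bool.
  apply/idP/idP => /set_mem; first by move=> Sa; apply/mem_set/SS; left.
  by move/SS => [Sa|//]; apply/mem_set.
- by move=> n a; rewrite indicE; case: (_ \in _); rewrite ?normr1 ?normr0.
- by apply: measurable_indic; exact: bigcupT_measurable.
move=> a; have [[n _ Fna]|Fa] := pselect ((\bigcup_k F k) a).
  apply: cvg_near_cst; exists n.+1 => // k /= nk; rewrite !indicE !mem_set//.
    by exists n.
  by exists n.
apply: cvg_near_cst; exists 0 => // k _; rewrite !indicE !memNset//.
by move=> [i _ Fia]; apply: Fa; exists i.
Qed.

(** The coefficient at 0 of [u * \1_A] is the integral of [u] over [A]. *)
Theorem fourier_null_ae0 u : fourier_null u -> {ae m, forall a, u a = 0}.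
Proof.
move=> ou; have iu : m.-integrable setT (EFin \o u) by case: ou.
have : ae_eq m setT (EFin \o u) (cst 0%E).
  apply: integral_ae_eq => // A _ mA.
  have [_ /(_ false 0)] := fourier_null_measurable ou mA.
  rewrite integral0 integral_mkcond /Rintegral => E.
  rewrite -[RHS]/(0%:E) -[in RHS]E fineK.
    apply: eq_integral => a _; rewrite /chpart /cpart /Xchar character0 /= mulr1.
    by rewrite indicE patchE; case: ifP; rewrite ?mulr1 ?mulr0.
  apply: integrable_fin_num => //; apply: integrable_chpart.
  by have [] := fourier_null_measurable ou mA.
by apply: filterS => a /(_ I) /= [].
Qed.

End FourierNull.

(** * Complex-valued integrable functions and their classes *)

Section ComplexL1Theory.
Context d (T : measurableType d) (R : realType) (mu : {measure set T -> \bar R}).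
Local Notation C := (Cplx R).
Implicit Types (f g w : T -> C) (u v : L1 mu).

Lemma cintegrableP f : f \in cintegrable mu <->
  mu.-integrable setT (EFin \o (fun x => complex.Re (f x))) /\
  mu.-integrable setT (EFin \o (fun x => complex.Im (f x))).
Proof. by rewrite unfold_in; split => [/andP|/andP]. Qed.

Lemma L1repr_integrable u : (L1repr u : T -> C) \in cintegrable mu.
Proof. exact: (valP (L1repr u)). Qed.

Lemma repr_pi_ae (f : L1fun mu) : {ae mu, forall x,
  (repr (\pi_(Quotient.quot (L1null (mu := mu))) f)%qT : L1fun mu) x = f x}.
Proof.
have : (repr (\pi_(Quotient.quot (L1null (mu := mu))) f)%qT : L1fun mu) - f
    \in L1null (mu := mu).
  by rewrite Quotient.idealrBE reprK.
by move=> /asboolP; apply: filterS => x /eqP; rewrite subr_eq0 => /eqP.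
Qed.

Lemma L1repr_class f : f \in cintegrable mu ->
  {ae mu, forall x, L1repr (L1class mu f) x = f x}.
Proof.
move=> fi; have := repr_pi_ae (insubd (0 : L1fun mu) f).
rewrite /L1repr /L1class; apply: filterS => x ->.
by rewrite -[in RHS](insubdK (0 : L1fun mu) fi).
Qed.

Lemma L1_eq u v : {ae mu, forall x, L1repr u x = L1repr v x} -> u = v.
Proof.
move=> uv; rewrite -[u](reprK (u : Quotient.quot _)) -[v](reprK (v : Quotient.quot _)).
apply/eqP; rewrite -Quotient.idealrBE; apply/asboolP.
by move: uv; apply: filterS => x uv; apply/eqP; rewrite subr_eq0; apply/eqP.
Qed.

Lemma L1reprD u v : {ae mu, forall x, L1repr (u + v) x = L1repr u x + L1repr v x}.
Proof.
have := repr_pi_ae (L1repr u + L1repr v).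
by rewrite Quotient.pi_add !reprK.
Qed.

Lemma L1reprZ (a : C) u : {ae mu, forall x, L1repr (a *: u) x = a * L1repr u x}.
Proof. exact: (repr_pi_ae (a *: L1repr u)). Qed.

Lemma cintegrable_lincomb (a : C) f g : f \in cintegrable mu ->
  g \in cintegrable mu -> (fun x => a * f x + g x) \in cintegrable mu.
Proof. by have [_ h] := cintegrable_submod_closed mu => fi gi; exact: (h a f g fi gi). Qed.

Let eqR (h k : T -> R) : mu.-integrable setT (EFin \o h) ->
  mu.-integrable setT (EFin \o k) -> {ae mu, forall x, h x = k x} ->
  (\int[mu]_x h x = \int[mu]_x k x)%R.
Proof.
move=> ih ik hk; congr fine; apply: ae_eq_integral => //.
- exact: measurable_int ih.
- exact: measurable_int ik.
- by apply: filterS hk => x /= -> _.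
Qed.

Lemma cintegral_ae f g : f \in cintegrable mu -> g \in cintegrable mu ->
  {ae mu, forall x, f x = g x} -> cintegral mu f = cintegral mu g.
Proof.
move=> /cintegrableP[fr fi] /cintegrableP[gr gi] fg.
by congr Complex; apply: eqR => //; apply: filterS fg => x ->.
Qed.

Lemma cintegral_lincomb (a : C) f g : f \in cintegrable mu ->
  g \in cintegrable mu ->
  cintegral mu (fun x => a * f x + g x) = a * cintegral mu f + cintegral mu g.
Proof.
move=> /cintegrableP[fr fi] /cintegrableP[gr gi].
case: a => p q; rewrite /cintegral [RHS]/GRing.add /=; congr Complex.
  rewrite (@Rintegral_ext _ _ _ mu _ (fun x =>
     1 * (p * complex.Re (f x) + - q * complex.Im (f x)) +
     1 * complex.Re (g x))).
    rewrite Rintegral_lincomb//; last exact: integrable_lincomb.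
    by rewrite Rintegral_lincomb//; ring.
  by move=> x; case: (f x) => a b; case: (g x) => a' b' /=; ring.
rewrite (@Rintegral_ext _ _ _ mu _ (fun x =>
     1 * (p * complex.Im (f x) + q * complex.Re (f x)) +
     1 * complex.Im (g x))).
  rewrite Rintegral_lincomb//; last exact: integrable_lincomb.
  by rewrite Rintegral_lincomb//; ring.
by move=> x; case: (f x) => a b; case: (g x) => a' b' /=; ring.
Qed.

Lemma measurable_cabs2 f :
  measurable_fun setT (fun x => complex.Re (f x)) ->
  measurable_fun setT (fun x => complex.Im (f x)) ->
  measurable_fun setT (fun x => Num.sqrt (cabs2 (f x))).
Proof.
move=> mr mi; apply: (@measurableT_comp _ _ _ _ _ _ (@Num.sqrt R)).
  by apply: continuous_measurable_fun; exact: sqrt_continuous.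
by apply: measurable_funD; apply: measurable_funX.
Qed.

Lemma cintegrable_norm f : f \in cintegrable mu ->
  mu.-integrable setT (EFin \o (fun x => Num.sqrt (cabs2 (f x)))).
Proof.
move=> /cintegrableP[fr fi].
apply: (@le_integrable _ _ _ mu setT measurableT _
  (fun x => `|(complex.Re (f x))%:E| + `|(complex.Im (f x))%:E|)%E).
- apply/measurable_EFinP; apply: measurable_cabs2.
    exact: (integrable_measurable fr).
  exact: (integrable_measurable fi).
- move=> x _; rewrite /= lee_fin ger0_norm ?sqrtr_ge0// ger0_norm ?addr_ge0//.
  exact: ler_cabs2.
- by apply: integrableD => //; exact: integrable_abse.
Qed.

Lemma L1normE u : L1norm u = Complex (\int[mu]_x Num.sqrt (cabs2 (L1repr u x)))%R 0.
Proof.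
rewrite /L1norm /cintegral; congr Complex.
  by apply: Rintegral_ext => x; rewrite normCE.
rewrite (@Rintegral_ext _ _ _ mu _ (fun=> 0)); first by rewrite /Rintegral integral0.
by move=> x; rewrite normCE.
Qed.

Lemma L1norm_ae u v : {ae mu, forall x, cabs2 (L1repr u x) = cabs2 (L1repr v x)} ->
  L1norm u = L1norm v.
Proof.
move=> uv; rewrite !L1normE; congr Complex.
apply: eqR; [exact/cintegrable_norm/L1repr_integrable..|].
by apply: filterS uv => x ->.
Qed.

Definition L1int u : C := cintegral mu (L1repr u).

Lemma L1int_lincomb (a : C) u v : L1int (a *: u + v) = a * L1int u + L1int v.
Proof.
rewrite /L1int -cintegral_lincomb; try exact: L1repr_integrable.
apply: cintegral_ae; first exact: L1repr_integrable.
  by apply: cintegrable_lincomb; exact: L1repr_integrable.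
have := L1reprD (a *: u) v; have := L1reprZ a u.
by apply: filterS2 => x E ->; rewrite E.
Qed.

Lemma L1int_class f : f \in cintegrable mu -> L1int (L1class mu f) = cintegral mu f.
Proof.
move=> fi; apply: cintegral_ae => //; [exact: L1repr_integrable|exact: L1repr_class].
Qed.

(** The modulus is bounded through the real and imaginary parts, hence the
    factor 2; only continuity of the integral matters in what follows. *)
Lemma L1int_le u : `|L1int u| <= 2 * L1norm u.
Proof.
have fi := L1repr_integrable u; have [fr fim] := (cintegrableP (L1repr u)).1 fi.
have ni := cintegrable_norm fi.
rewrite L1normE normCE lecE /= !(mulr0, mul0r, addr0, subr0) eqxx /=.
apply: le_trans (ler_cabs2 _) _; rewrite -[1 + 1]/(2 : R) mulrDl !mul1r /=.
apply: lerD; apply: (le_trans (le_normr_Rintegral _ _)) => //.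
  apply: le_Rintegral => //; first exact: (integrable_abse fr).
  by move=> x _; exact: ler_norm_Re.
apply: le_Rintegral => //; first exact: (integrable_abse fim).
by move=> x _; exact: ler_norm_Im.
Qed.

Section Unimodular.
Variable w : T -> C.
Hypothesis wr : measurable_fun setT (fun x => complex.Re (w x)).
Hypothesis wi : measurable_fun setT (fun x => complex.Im (w x)).
Hypothesis w1 : forall x, `|w x| = 1.

Lemma unimodular_cabs2 x : cabs2 (w x) = 1.
Proof.
have := w1 x; rewrite normCE => -[/(congr1 (fun r => r ^+ 2))].
by rewrite sqr_sqrtr ?expr1n ?cabs2_ge0.
Qed.

Lemma cintegrableM f : f \in cintegrable mu -> (fun x => f x * w x) \in cintegrable mu.
Proof.
move=> /cintegrableP[fr fi]; apply/cintegrableP.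
have wr1 x : `|complex.Re (w x)| <= 1.
  by have := ler_norm_Re (w x); rewrite unimodular_cabs2 sqrtr1.
have wi1 x : `|complex.Im (w x)| <= 1.
  by have := ler_norm_Im (w x); rewrite unimodular_cabs2 sqrtr1.
split.
  have := integrable_lincomb 1 (- 1) (integrableM_bounded fr wr wr1)
    (integrableM_bounded fi wi wi1).
  apply: eq_integrable => // x _ /=; congr EFin.
  by case: (f x) => a b; case: (w x) => a' b' /=; ring.
have := integrable_lincomb 1 1 (integrableM_bounded fr wi wi1)
    (integrableM_bounded fi wr wr1).
apply: eq_integrable => // x _ /=; congr EFin.
by case: (f x) => a b; case: (w x) => a' b' /=; ring.
Qed.

Definition L1mul u : L1 mu := L1class mu (fun x => L1repr u x * w x).

Lemma L1mul_ae u : {ae mu, forall x, L1repr (L1mul u) x = L1repr u x * w x}.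
Proof. by apply: L1repr_class; apply: cintegrableM; exact: L1repr_integrable. Qed.

Lemma L1mul_lincomb (a : C) u v : L1mul (a *: u + v) = a *: L1mul u + L1mul v.
Proof.
apply: L1_eq.
have := L1mul_ae (a *: u + v); have := L1mul_ae u; have := L1mul_ae v.
have := L1reprD (a *: u) v; have := L1reprZ a u.
have := L1reprD (a *: L1mul u) (L1mul v); have := L1reprZ a (L1mul u).
move=> h1 h2 h3 h4 h5 h6 h7.
near=> x.
rewrite (near h7 x _)// (near h2 x _)// (near h1 x _)// (near h6 x _)// (near h5 x _)//.
by rewrite (near h4 x _)// (near h3 x _)// mulrDl mulrA.
Unshelve. all: by end_near. Qed.

Lemma L1norm_mul u : L1norm (L1mul u) = L1norm u.
Proof.
apply: L1norm_ae; apply: filterS (L1mul_ae u) => x ->.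
by rewrite cabs2M unimodular_cabs2 mulr1.
Qed.

Lemma L1mul_class f : f \in cintegrable mu ->
  L1mul (L1class mu f) = L1class mu (fun x => f x * w x).
Proof.
move=> fi; apply: L1_eq.
have h3 := L1mul_ae (L1class mu f); have h2 := L1repr_class fi.
have h1 := L1repr_class (cintegrableM fi); near=> x.
by rewrite (near h3 x _)// (near h2 x _)// (near h1 x _).
Unshelve. all: by end_near. Qed.

Lemma L1int_mul u : L1int (L1mul u) = cintegral mu (fun x => L1repr u x * w x).
Proof. by apply: L1int_class; apply: cintegrableM; exact: L1repr_integrable. Qed.

End Unimodular.

End ComplexL1Theory.

(** * Haar integrals of characters *)

Section Haar.
Variables (R : realType) (G : zmodType).
Local Notation C := (Cplx R).
Local Notation dual := (dual R G).
Variable m : probability dual R.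
Hypothesis G_countable : countable [set: G].
Hypothesis m_haar : is_haar m.

Lemma Xchar_integrable g : Xchar g \in cintegrable m.
Proof.
have i1 : m.-integrable setT (EFin \o cst (1 : R)).
  exact: finite_measure_integrable_cst.
apply/cintegrableP; split.
  have := integrable_chpart false g i1; apply: eq_integrable => // a _.
  by rewrite /= mul1r.
have := integrable_chpart true g i1; apply: eq_integrable => // a _.
by rewrite /= mul1r.
Qed.

Lemma characterV_unit (a : character R G) g : `|a (- g)| = 1.
Proof. exact: character_unit. Qed.

Lemma characterV_D (a : character R G) g h : a (- (g + h)) = a (- g) * a (- h).
Proof. by rewrite opprD characterD. Qed.

Definition characterV (a : character R G) : character R G :=
  @Character _ _ (fun g => a (- g)) (characterV_unit a) (characterV_D a).

Lemma characterMV a b : characterM a (characterM (characterV a) b) = b.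
Proof.
apply/character_inj/funext => g /=.
by rewrite mulrA -characterD subrr character0 mul1r.
Qed.

Lemma characterVM a b : characterM (characterV a) (characterM a b) = b.
Proof.
apply/character_inj/funext => g /=.
by rewrite mulrA -characterD addNr character0 mul1r.
Qed.

(** On a half space, the condition on [a * b] is a condition on a real linear
    combination of the two parts of the character [Xchar g] at [b]. *)
Lemma measurable_translation (a : character R G) :
  measurable_fun setT (characterM a : dual -> dual).
Proof.
apply: (measurability _ (dual_measurableE R G_countable)).
move=> _ [_ [L _ <-] <-]; rewrite setTI.
elim: L => [|c L IH]; first by rewrite box_nil preimage_setT.
rewrite box_cons preimage_setI; apply: measurableI => //.
case: c {IH} => [[[g b] s] q].
have -> : (characterM a : dual -> dual) @^-1`
   (half_space (g, b, s, q)) =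
   (fun b' : dual => hsign s (cpart b (a g * Xchar g b'))) @^-1` `]-oo, (ratr q)[.
  by apply/seteqP; split => b'; rewrite /= in_itv.
rewrite -[X in measurable X]setTI.
have : measurable_fun setT (fun b' : dual => hsign s (cpart b (a g * Xchar g b'))).
  suff : measurable_fun setT (fun b' : dual => cpart b (a g * Xchar g b')).
    by rewrite /hsign; case: s => //= ?; exact: measurableT_comp.
  have mr := measurable_chpart (R := R) false g.
  have mi := measurable_chpart (R := R) true g.
  case: (a g) => x y; case: b.
    have -> : (fun b' : dual => cpart true ((x +i* y)%C * Xchar g b')) =
      (fun b' => x * chpart true g b' + y * chpart false g b').
      by apply/funext => b'; rewrite /chpart /cpart; case: (Xchar g b').
    by apply: measurable_funD; apply: measurable_funM.
  have -> : (fun b' : dual => cpart false ((x +i* y)%C * Xchar g b')) =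
      (fun b' => x * chpart false g b' - y * chpart true g b').
      by apply/funext => b'; rewrite /chpart /cpart; case: (Xchar g b').
  by apply: measurable_funB; apply: measurable_funM.
apply=> //; exact: measurable_itv.
Qed.

(** The inverse character turns the invariance of the measure of images, which
    is how [is_haar] is stated, into invariance of preimages. *)
Lemma haar_translation (a : character R G) (h : dual -> R) :
  measurable_fun setT h -> m.-integrable setT (EFin \o (h \o characterM a)) ->
  (\int[m]_b h (characterM a b) = \int[m]_b h b)%R.
Proof.
move=> mh ih; congr fine.
have mt := measurable_translation a.
rewrite -[LHS](@integral_pushforward _ _ _ _ _ _ mt m setT (EFin \o h))//.
  apply: eq_measure_integral => A mA _ /=.
  rewrite /pushforward -[RHS](m_haar (characterV a) mA); congr (m _).
  apply/seteqP; split=> [b Ab|_ [b Ab <-]].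
    by exists (characterM a b) => //; exact: characterVM.
  by rewrite /= characterMV.
exact/measurable_EFinP.
Qed.

(** Translating by [a] multiplies the integral by [a g]. *)
Lemma integral_character (a : character R G) g : a g != 1 ->
  cintegral m (Xchar g) = 0.
Proof.
move=> ag1; have Xi := Xchar_integrable g.
have iX : (fun b => a g * Xchar g b + 0) \in cintegrable m.
  apply: cintegrable_lincomb => //.
  by have [h _] := cintegrable_submod_closed m.
have E : cintegral m (fun b => a g * Xchar g b + 0) = cintegral m (Xchar g).
  have /cintegrableP[ir ii] := iX.
  congr Complex.
    rewrite -[RHS](@haar_translation a (chpart false g)).
    - by apply: Rintegral_ext => b; rewrite addr0.
    - exact: measurable_chpart.
    - by apply: eq_integrable ir => // b _ /=; rewrite addr0.
  rewrite -[RHS](@haar_translation a (chpart true g)).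
  - by apply: Rintegral_ext => b; rewrite addr0.
  - exact: measurable_chpart.
  - by apply: eq_integrable ii => // b _ /=; rewrite addr0.
move: E; rewrite cintegral_lincomb//; last first.
  by have [h _] := cintegrable_submod_closed m.
have -> : cintegral m (fun=> 0) = 0.
  by rewrite /cintegral /Rintegral /= integral0.
rewrite addr0 => /eqP; rewrite -subr_eq0 -[X in _ - X]mul1r -mulrBl mulf_eq0.
by rewrite subr_eq0 (negPf ag1) => /eqP.
Qed.

Lemma integral_character0 : cintegral m (Xchar 0) = 1.
Proof.
have X0 : @Xchar R G 0 = (fun=> 1) by apply/funext => a; exact: character0.
rewrite /cintegral X0 /=.
rewrite Rintegral_cst// [X in Complex _ X](_ : _ = 0); last first.
  by rewrite /Rintegral integral0.
congr Complex; rewrite mul1r; exact: (congr1 fine (probability_setT m)).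
Qed.

End Haar.

(** * Extension by continuity from the span of the translations *)

Section Extension.
Variables (R : realType) (G : zmodType).
Local Notation C := (Cplx R).
Variables (E : completeNormedModType C) (j : (ell2 R G -> ell2 R G) -> E).
Hypothesis j_dense : dense (j @` span_rho).

(** Density makes the filter in the definition of [extend] proper, and [j] tends
    to [x] along it, so that [f = phi \o j] tends to [phi x]. *)
Lemma extend_continuous (W : ptopologicalType) (f : (ell2 R G -> ell2 R G) -> W)
    (phi : E -> W) (x : E) : hausdorff_space W -> continuous phi ->
  (forall F, span_rho F -> f F = phi (j F)) -> extend j f x = phi x.
Proof.
move=> hW cphi fphi; rewrite /extend.
set FF := filter_from _ _.
have PF : ProperFilter FF.
  apply: filter_from_proper.
    apply: filter_from_filter; first by exists setT; exact: filterT.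
    move=> U V xU xV; exists (U `&` V); first exact: filterI.
    by move=> F [? [? ?]].
  move=> U; rewrite nbhsE => -[V [oV Vx] VU].
  have [y [Vy [F sF Fy]]] := j_dense (ex_intro _ x Vx) oV.
  by exists F; split => //; apply: VU; rewrite /= Fy.
apply: cvg_lim => // N /cphi xN.
by exists (phi @^-1` N) => // F [sF /= NF]; rewrite /= fphi.
Qed.

Lemma lipschitz_continuous (W : normedModType C) (phi : E -> W) :
  (forall x y, `|phi x - phi y| <= 2 * `|x - y|) -> continuous phi.
Proof.
move=> le x; apply/(@cvgrPdist_lt _ _ _ (nbhs x)) => e e0.
have e20 : 0 < e / 2 by rewrite divr_gt0.
move: (nbhsx_ballx x _ e20); apply: filterS => y.
rewrite -ball_normE /= ltr_pdivlMr// mulrC; exact: le_lt_trans.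
Qed.

End Extension.

(** * The multiplier map and the trace *)

Section Span.
Variables (R : realType) (G : zmodType).
Local Notation C := (Cplx R).
Implicit Types (s : seq G) (c : G -> C).

Lemma span_rho_sum s c : span_rho (\sum_(h <- s) c h *: rho h).
Proof. by exists s, c. Qed.

Lemma span_rho1 g : span_rho (@rho R G g).
Proof. by exists [:: g], (fun=> 1); rewrite big_seq1 scale1r. Qed.

Lemma sum_rho_comp s c g :
  (\sum_(h <- s) c h *: @rho R G h) \o rho g =
  \sum_(k <- [seq h + g | h <- s]) c (k - g) *: rho k.
Proof.
apply/funext => x; rewrite big_map /= !fct_sumE; apply: eq_bigr => h _.
by rewrite addrK /= !fctE rhoD.
Qed.

Lemma tau_lincomb (a : C) (F F' : ell2 R G -> ell2 R G) :
  tau (a *: F + F') = a * tau F + tau F'.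
Proof. by rewrite /tau ell2_dotDl ell2_dotZl. Qed.

Lemma tau_rho g : tau (@rho R G g) = (g == 0)%:R.
Proof.
rewrite /tau ell2_dot_delta /= /delta_fun add0r //.
Qed.

Lemma fourier_rho g : fourier (@rho R G g) (- g) = 1.
Proof.
rewrite /fourier (_ : _ \o _ = rho 0) ?tau_rho ?eqxx//.
by apply/funext => x; rewrite /= rhoD subrr.
Qed.

End Span.

Section Multiplier.
Variables (R : realType) (G : zmodType).
Local Notation C := (Cplx R).
Local Notation op := (ell2 R G -> ell2 R G).
Variable m : probability (dual R G) R.
Hypothesis G_countable : countable [set: G].
Hypothesis m_haar : is_haar m.
Variables (E : completeNormedModType C) (j : op -> E).
Hypothesis jP : is_L1_completion j.
Variable Lambda : {linear E -> L1 m}.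
Hypothesis LambdaP : is_multiplier_map j Lambda.

Let j_lin (a : C) (F F' : op) : span_rho F -> span_rho F' ->
  j (a *: F + F') = a *: j F + j F'.
Proof. by case: jP => + _ _; apply. Qed.

Let j0 : j 0 = 0.
Proof.
have s0 : span_rho (0 : op) by exists [::], (fun=> 0); rewrite big_nil.
have := j_lin 1 s0 s0; rewrite !scale1r addr0 => /eqP.
by rewrite -subr_eq0 opprD addrA subrr sub0r oppr_eq0 => /eqP.
Qed.

Local Notation Xclass g := (L1class m (@Xchar R G g)).

(** [rho h] is the adjoint of [rho (- h)], with coefficient 1, and [Xchar h] is
    the conjugate of [Xchar (- h)]. *)
Lemma multiplier_rho h : Lambda (j (rho h)) = Xclass h.
Proof.
have [LF _ _] := LambdaP.
rewrite (LF [fset (- h)]%fset); last first.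
  by rewrite big_seq_fset1 fourier_rho adjoint_rho opprK scale1r.
rewrite big_seq_fset1 fourier_rho scale1r; congr L1class.
by apply/funext => a; rewrite /Xchar characterN conjCK.
Qed.

Lemma multiplier_span s (c : G -> C) :
  Lambda (j (\sum_(h <- s) c h *: rho h)) = \sum_(h <- s) c h *: Xclass h.
Proof.
elim: s => [|h s IH]; first by rewrite !big_nil j0 linear0.
rewrite !big_cons j_lin; [|exact: span_rho1|exact: span_rho_sum].
by rewrite linearP IH multiplier_rho.
Qed.

(** Otherwise the characters [Xchar g] and [Xchar (- g)] would be constant, and
    [Lambda] would send the Laplacian to [1 + 1 - 1 - 1 = 0]; as [Lambda] is
    injective, the trace norm of the Laplacian would vanish. *)
Lemma character_neq1 (g : G) : g != 0 -> exists a : character R G, a g != 1.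
Proof.
move=> g0; apply: contrapT => /forallNP ag.
have X1 (a : character R G) : a g = 1 by apply/eqP/negPn/negP; exact: ag.
(* This gives the right coefficients even if [g = - g], where the term [g]
   occurs twice in the sequence with coefficient -1. *)
pose c (k : G) : C := if k == 0 then 2 else - 1.
have lapE : laplacian g = \sum_(h <- [:: 0; g; - g]) c h *: @rho R G h.
  rewrite !big_cons big_nil addr0 /c eqxx (negPf g0) oppr_eq0 (negPf g0).
  exact: laplacian_span.
have Xg : @Xchar R G g = Xchar 0.
  by apply/funext => a; rewrite /Xchar X1 character0.
have XNg : @Xchar R G (- g) = Xchar 0.
  by apply/funext => a; rewrite /Xchar characterN X1 rmorph1 character0.
have L0 : Lambda (j (laplacian g)) = 0.
  rewrite lapE multiplier_span !big_cons big_nil addr0 Xg XNg -!scalerDl.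
  rewrite /c eqxx (negPf g0) oppr_eq0 (negPf g0).
  by rewrite (_ : _ + _ = 0) ?scale0r//; ring.
have [_ jn _] := jP; have [_ _ /bij_inj Linj] := LambdaP.
have /negP := trace_norm_laplacian R g0; apply.
rewrite -jn; last by rewrite lapE; exact: span_rho_sum.
by rewrite (_ : j _ = 0) ?normr0//; apply: Linj; rewrite L0 linear0.
Qed.

Lemma integral_Xchar (g : G) : cintegral m (Xchar g) = (g == 0)%:R.
Proof.
have [->|g0] := eqVneq g 0; first exact: integral_character0.
by have [a ag] := character_neq1 g0; rewrite (integral_character _ _ ag).
Qed.

Let L1int0 : L1int (0 : L1 m) = 0.
Proof.
by have := L1int_lincomb (- 1) (0 : L1 m) 0; rewrite scaler0 addr0 mulN1r addNr.
Qed.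

(** Both sides pick the coefficient of [rho 0] in [F]: on the right, because the
    nontrivial characters have zero Haar integral. *)
Lemma tau_multiplier F : span_rho F -> tau F = L1int (Lambda (j F)).
Proof.
move=> [s [c ->]]; rewrite multiplier_span; elim: s => [|h s IH].
  by rewrite !big_nil L1int0 /tau ell2_dot_delta.
rewrite !big_cons tau_lincomb L1int_lincomb -IH; congr (_ + _).
by rewrite L1int_class ?Xchar_integrable// integral_Xchar tau_rho.
Qed.

Let wr g : measurable_fun setT (fun a => complex.Re (@Xchar R G g a)).
Proof. exact: (measurable_chpart false g). Qed.
Let wi g : measurable_fun setT (fun a => complex.Im (@Xchar R G g a)).
Proof. exact: (measurable_chpart true g). Qed.
Let w1 g a : `|@Xchar R G g a| = 1.
Proof. exact: character_unit. Qed.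

Lemma multiplier_comp_rho F g : span_rho F ->
  Lambda (j (F \o rho g)) = L1mul (Xchar g) (Lambda (j F)).
Proof.
move=> [s [c ->]]; rewrite sum_rho_comp !multiplier_span big_map.
have lin := L1mul_lincomb (mu := m) (wr g) (wi g) (w1 g).
elim: s => [|h s IH].
  rewrite !big_nil; have := lin (- 1) 0 0.
  by rewrite scaler0 addr0 scaleN1r addNr => ->.
rewrite !big_cons lin -IH addrK; congr (_ *: _ + _).
rewrite (L1mul_class (wr g) (wi g) (w1 g)) ?Xchar_integrable//; congr L1class.
by apply/funext => a; rewrite /Xchar characterD.
Qed.

Let norm_Lambda x : L1norm (Lambda x) = `|x|.
Proof. by case: LambdaP. Qed.

Lemma tauL1E x : tauL1 j x = L1int (Lambda x).
Proof.
have [_ _ jd] := jP.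
apply: (@extend_continuous R G E j jd _ _ (fun x => L1int (Lambda x) : C)) => //.
- apply: (lipschitz_continuous (W := C)) => y z.
  rewrite -norm_Lambda linearB; apply: le_trans (L1int_le _).
  have := L1int_lincomb (- 1) (Lambda z) (Lambda y).
  by rewrite scaleN1r mulN1r addrC [in X in _ = X]addrC => ->.
- exact: tau_multiplier.
Qed.

(** Right composition with [rho g] extends to the isometry obtained by carrying
    multiplication by [Xchar g] over to the completion through [Lambda]. *)
Lemma fourierL1E x g :
  fourierL1 j x g = cintegral m (fun a => L1repr (Lambda x) a * Xchar g a).
Proof.
have [_ _ jd] := jP; have [_ _ [V LK VK]] := LambdaP.
pose M y := V (L1mul (Xchar g) (Lambda y)).
have lin := L1mul_lincomb (mu := m) (wr g) (wi g) (w1 g).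
rewrite /fourierL1 (_ : mulL1_rho j g x = M x).
  by rewrite tauL1E VK (L1int_mul (wr g) (wi g) (w1 g)).
apply: (@extend_continuous R G E j jd _ _ M) => //.
- apply: lipschitz_continuous => y z.
  have -> : `|M y - M z| = `|y - z|.
    rewrite -[LHS]norm_Lambda linearB !VK -[RHS]norm_Lambda linearB.
    rewrite -(L1norm_mul (wr g) (wi g) (w1 g) (Lambda y - Lambda z)); congr L1norm.
    by rewrite addrC -scaleN1r -lin scaleN1r addrC.
  by rewrite ler_peMl// ler1n.
- by move=> F sF; rewrite /M -multiplier_comp_rho// LK.
Qed.

End Multiplier.

(** * Uniqueness of Fourier coefficients *)

Section FourierUniqueness.
Variables (R : realType) (G : zmodType).
Variable m : probability (dual R G) R.
Hypothesis G_countable : countable [set: G].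
Local Notation C := (Cplx R).

(** Taking real and imaginary parts of the coefficients at [g] and [- g]
    separates those of the real part of [u - v] from those of its imaginary
    part, which reduces to the real case. *)
Lemma Fourier_inj (u v : L1 m) :
  (forall g, cintegral m (fun a => L1repr u a * Xchar g a) =
             cintegral m (fun a => L1repr v a * Xchar g a)) -> u = v.
Proof.
move=> uv; pose f a : C := - 1 * L1repr v a + L1repr u a.
have fi : f \in cintegrable m by apply: cintegrable_lincomb; exact: L1repr_integrable.
have /cintegrableP[fr fim] := fi.
have f0 g : cintegral m (fun a => f a * Xchar g a) = 0.
  have Xi (w : L1 m) : (fun a => L1repr w a * Xchar g a) \in cintegrable m.
    apply: cintegrableM; last exact: L1repr_integrable.
    - exact: (measurable_chpart false g).
    - exact: (measurable_chpart true g).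
    - by move=> a; exact: character_unit.
  have -> : (fun a => f a * Xchar g a) =
      (fun a => - 1 * (L1repr v a * Xchar g a) + L1repr u a * Xchar g a).
    by apply/funext => a; rewrite /f mulrDl mulrA.
  by rewrite cintegral_lincomb// uv mulN1r addNr.
pose ur a := complex.Re (f a); pose ui a := complex.Im (f a).
have comb (p q : R) (b b' : bool) g :
  (\int[m]_a (p * (ur a * chpart b g a) + q * (ui a * chpart b' g a)) =
   p * \int[m]_a (ur a * chpart b g a) + q * \int[m]_a (ui a * chpart b' g a))%R.
  by rewrite Rintegral_lincomb//; exact: integrable_chpart.
have re0 g : (\int[m]_a (ur a * chpart false g a) -
              \int[m]_a (ui a * chpart true g a) = 0)%R.
  have [+ _] := f0 g; have := comb 1 (- 1) false true g.
  rewrite mul1r mulN1r => <- <-; apply: Rintegral_ext => a.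
  by rewrite /ur /ui /chpart /cpart; case: (f a) => x y; case: (Xchar g a) => x' y' /=; ring.
have im0 g : (\int[m]_a (ur a * chpart true g a) +
              \int[m]_a (ui a * chpart false g a) = 0)%R.
  have [_ +] := f0 g; have := comb 1 1 true false g.
  rewrite !mul1r => <- <-; apply: Rintegral_ext => a.
  by rewrite /ur /ui /chpart /cpart; case: (f a) => x y; case: (Xchar g a) => x' y' /=; ring.
have reN (h : dual R G -> R) g :
    (\int[m]_a (h a * chpart false (- g) a) = \int[m]_a (h a * chpart false g a))%R.
  by apply: Rintegral_ext => a; rewrite /chpart /cpart /Xchar characterN conjcE.
have imN (h : dual R G -> R) g : m.-integrable setT (EFin \o h) ->
    (\int[m]_a (h a * chpart true (- g) a) = - \int[m]_a (h a * chpart true g a))%R.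
  move=> ih; rewrite -mulN1r -RintegralZl//; last exact: integrable_chpart.
  apply: Rintegral_ext => a.
  by rewrite /chpart /cpart /Xchar characterN conjcE /= mulN1r mulrN.
have our : fourier_null m ur.
  split=> // b g; have := re0 g; have := re0 (- g); have := im0 g; have := im0 (- g).
  rewrite !reN !imN//; case: b; lra.
have oui : fourier_null m ui.
  split=> // b g; have := re0 g; have := re0 (- g); have := im0 g; have := im0 (- g).
  rewrite !reN !imN//; case: b; lra.
apply: L1_eq.
have := fourier_null_ae0 G_countable our; have := fourier_null_ae0 G_countable oui.
apply: filterS2 => a; rewrite /ur /ui /f mulN1r.
case: (L1repr u a) => x y; case: (L1repr v a) => x' y' /= e1 e2.
by congr Complex; lra.
Qed.

End FourierUniqueness.

Theorem theorem14 (R : realType)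
  (Gamma : zmodType) (Gamma_countable : countable [set: Gamma])
  (haar : probability (dual R Gamma) R) (haarP : is_haar haar)
  (H : completeNormedModType (Cplx R)) (ip : {dot H for Num.conj})
  (ip_norm : forall x : H, `|x| ^+ 2 = ip x x)
  (H_separable : exists2 D : set H, countable D & dense D)
  (Pi : Gamma -> {linear H -> H}) (PiP : is_unitary_rep ip Pi)
  (L1vN : completeNormedModType (Cplx R))
  (j : (ell2 R Gamma -> ell2 R Gamma) -> L1vN) (jP : is_L1_completion j)
  (Pi_dual_integrable : dual_integrable ip Pi j)
  (br_op : {bilinear H -> H -> L1vN | *:%R &
              (Num.conj : Cplx R -> Cplx R) \; *:%R})
  (br_opP : is_operator_bracket ip Pi j br_op)
  (br : {bilinear H -> H -> L1 haar | *:%R &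
           (Num.conj : Cplx R -> Cplx R) \; *:%R})
  (brP : is_function_bracket ip Pi br)
  (Lambda : {linear L1vN -> L1 haar}) (LambdaP : is_multiplier_map j Lambda)
  (psi1 psi2 : H) :
  Lambda (br_op psi1 psi2) = br psi1 psi2.
Proof.
apply: (Fourier_inj Gamma_countable) => g.
by rewrite -(fourierL1E Gamma_countable haarP jP LambdaP) -br_opP brP.
Qed.
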